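(* Let $X_1,X_2,\dots$ be i.i.d. with law $P_{S^1,\theta^*}$ where $\theta^*=(w^*,\tau_1^{*2},\tau_2^{*2})\in\Theta$ and $|w^*|>0$ (i.e. the true structure is $S^1$ with parameter $\theta^*$), and let $\mathcal{D}_{\mathrm{obs}}=(X_i)_{1\le i\le n}$. Assume that the prior densities $\pi(\theta\mid S)$ are four times differentiable for every $S\in\{S^1,S^2,S^3\}$. Then, as $n\to\infty$, $$\pi(S^1\mid \mathcal{D}_{\mathrm{obs}})\xrightarrow{a.s.}\frac{1}{1+\dfrac{\tau_2^{*2}}{w^{*2}\tau_2^{*2}+\tau_1^{*2}}\cdot\dfrac{\pi(\gamma(\theta^* )\mid S^2)}{\pi(\theta^*\mid S^1)}}.$$ Moreover, $$\frac{\tau_2^{*2}}{w^{*2}\tau_2^{*2}+\tau_1^{*2}}\cdot\frac{\pi(\gamma(\theta^* )\mid S^2)}{\pi(\theta^*\mid S^1)}=\frac{(\gamma^{-1}\#\pi)(\theta^*\mid S^2)}{\pi(\theta^*\mid S^1)},$$ where $(\gamma^{-1}\#\pi)(\cdot\mid S^2)$ is the density of the push-forward of the prior $\pi(\cdot\mid S^2)$ under the map $\gamma^{-1}$.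
   Context: Models. Let $\Theta=\mathbb{R}\times(0,\infty)^2$ with elements $\theta=(w,\tau_1^2,\tau_2^2)$. Let $\epsilon=(\epsilon(1),\epsilon(2))$ be centered Gaussian with covariance $\mathrm{Diag}(\tau_1^2,\tau_2^2)$. For each structure $S$ and parameter $\theta$, $P_{S,\theta}$ is the law of $X=(X(1),X(2))\in\mathbb{R}^2$ given by: - $S^1$: $X(2)=\epsilon(2)$, $X(1)=wX(2)+\epsilon(1)$ (edge $X(2)\to X(1)$); - $S^2$: $X(1)=\epsilon(1)$, $X(2)=wX(1)+\epsilon(2)$ (edge $X(1)\to X(2)$); - $S^3$: $X(1)=\epsilon(1)$, $X(2)=\epsilon(2)$ (independence model; $w$ is fixed to $0$ and the only free parameters are $(\tau_1^2,\tau_2^2)\in(0,\infty)^2$). $f(x\mid S,\theta)$ denotes the Lebesgue density of $P_{S,\theta}$. Prior and posterior. The prior on structures is uniform, $\pi(S^j)=1/3$. Given $S$, the parameter has a prior probability density $\pi(\theta\mid S)$ on its parameter space ($\Theta$ for $S^1,S^2$; for $S^3$ a density on the variances $(\tau_1^2,\tau_2^2)\in(0,\infty)^2$). With $\mathcal{D}_{\mathrm{obs}}=(X_i)_{1\le i\le n}$ and $f(\mathcal{D}_{\mathrm{obs}}\mid S,\theta)=\prod_{i=1}^n f(X_i\mid S,\theta)$, $$\pi(S\mid\mathcal{D}_{\mathrm{obs}})=\frac{\int f(\mathcal{D}_{\mathrm{obs}}\mid S,\theta)\pi(\theta\mid S)\,d\theta}{\sum_{j=1}^3\int f(\mathcal{D}_{\mathrm{obs}}\mid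 S^j,\theta)\pi(\theta\mid S^j)\,d\theta},$$ each integral being over the parameter space of the corresponding structure. The map $\gamma:\Theta\to\Theta$ is the bijection $$\gamma(w,\tau_1^2,\tau_2^2)=\left(\frac{w\tau_2^2}{w^2\tau_2^2+\tau_1^2},\ w^2\tau_2^2+\tau_1^2,\ \frac{\tau_1^2\tau_2^2}{w^2\tau_2^2+\tau_1^2}\right).$$ *)

(* Defs.v *)
From HB Require Import structures.
From mathcomp Require Import all_boot all_order all_algebra finmap.
From mathcomp Require Import all_classical all_reals all_analysis.

Set Implicit Arguments.
Unset Strict Implicit.
Unset Printing Implicit Defensive.

Import Order.TTheory GRing.Theory Num.Theory.
Import numFieldNormedType.Exports.

Local Open Scope classical_set_scope.
Local Open Scope ring_scope.

(* [S1] is X(2) -> X(1), [S2] is X(1) -> X(2), [S3] is the independence model. *)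
Inductive structure := S1 | S2 | S3.

(* R^2 and R^3 as measurable spaces: the library's Lebesgue and normal measures
   live on [measurableTypeR R], which is convertible to [R] and carries the Borel
   sigma-algebra, but under another display than [R] itself. *)
Notation mR2 R := (measurableTypeR R * measurableTypeR R)%type.
Notation mR3 R :=
  (measurableTypeR R * measurableTypeR R * measurableTypeR R)%type.

Section models.
Context {R : realType}.

(* A parameter is (w, tau_1^2, tau_2^2): the last two components are variances,
   not standard deviations. *)
Definition Theta : set (R * R * R) :=
  [set theta | 0 < theta.1.2 /\ 0 < theta.2].

Definition Theta3 : set (R * R) := [set tau | 0 < tau.1 /\ 0 < tau.2].

Definition lebesgue2 : {measure set (mR2 R) -> \bar R} :=
  (lebesgue_measure \x lebesgue_measure)%E.

Definition lebesgue3 : {measure set (mR3 R) -> \bar R} :=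
  (lebesgue_measure \x lebesgue_measure \x lebesgue_measure)%E.

(* [normal_prob] takes a standard deviation, hence the square roots. *)
Definition noise (t1 t2 : R) : set (mR2 R) -> \bar R :=
  (normal_prob 0 (Num.sqrt t1) \x normal_prob 0 (Num.sqrt t2))%E.

Definition structural (S : structure) (w : R) (e : R * R) : R * R :=
  match S with
  | S1 => (w * e.2 + e.1, e.2)
  | S2 => (e.1, w * e.1 + e.2)
  | S3 => e
  end.

Definition law (S : structure) (theta : R * R * R) : set (mR2 R) -> \bar R :=
  pushforward (noise theta.1.2 theta.2) (structural S theta.1.1).

Definition is_density d (T : measurableType d) (mu : {measure set T -> \bar R})
    (U : set T) (nu : set T -> \bar R) (f : T -> R) : Prop :=
  [/\ measurable_fun U f,
      forall x, U x -> 0 <= f x &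
      forall A, measurable A ->
        nu A = (\int[mu]_(x in A `&` U) (f x)%:E)%E].

(* Densities are only determined almost everywhere; since they are evaluated at
   points, the continuous version (which is unique) is the one meant. *)
Definition density (S : structure) (theta : R * R * R) : R * R -> R :=
  get [set f : R * R -> R |
        continuous f /\ is_density lebesgue2 setT (law S theta) f].

Definition density_on_Theta (nu : set (mR3 R) -> \bar R) : R * R * R -> R :=
  get [set f : R * R * R -> R |
        (forall theta, Theta theta -> {for theta, continuous f}) /\
        is_density lebesgue3 Theta nu f].

Definition is_prior d (T : measurableType d) (mu : {measure set T -> \bar R})
    (U : set T) (p : T -> R) : Prop :=
  [/\ measurable_fun U p,
      forall x, U x -> 0 <= p x &
      (\int[mu]_(x in U) (p x)%:E = 1)%E].

Definition prior_measure (p : R * R * R -> R) (A : set (mR3 R)) : \bar R :=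
  (\int[lebesgue3]_(theta in A `&` Theta) (p theta)%:E)%E.

(* In finite dimension the k-th derivative, a map into multilinear forms, is
   differentiable iff all its evaluations at fixed directions are; this is
   k-fold Frechet differentiability at every point of the open set [U]. *)
Fixpoint times_differentiable (k : nat) (V : normedModType R) (U : set V)
    (f : V -> R) : Prop :=
  if k is k'.+1 then
    (forall x, U x -> differentiable f x) /\
    (forall v, times_differentiable k' U (fun x => 'D_v f x))
  else True.

Definition likelihood (S : structure) (theta : R * R * R)
    (n : nat) (x : nat -> R * R) : R :=
  \prod_(i < n) density S theta (x i).

(* These are real-valued [Rintegral]s, equal to 0 when the integral diverges; for
   i.i.d. data with a nondegenerate Gaussian law that almost surely does not
   happen once n >= 2. *)
Definition evidence (p1 p2 : R * R * R -> R) (p3 : R * R -> R)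
    (n : nat) (x : nat -> R * R) (S : structure) : R :=
  match S with
  | S1 => \int[lebesgue3]_(theta in Theta) (likelihood S1 theta n x * p1 theta)
  | S2 => \int[lebesgue3]_(theta in Theta) (likelihood S2 theta n x * p2 theta)
  | S3 => \int[lebesgue2]_(tau in Theta3)
            (likelihood S3 (0, tau.1, tau.2) n x * p3 tau)
  end.

Definition posterior (p1 p2 : R * R * R -> R) (p3 : R * R -> R)
    (n : nat) (x : nat -> R * R) (S : structure) : R :=
  evidence p1 p2 p3 n x S /
  (evidence p1 p2 p3 n x S1 + evidence p1 p2 p3 n x S2
   + evidence p1 p2 p3 n x S3).

Definition gamma (theta : R * R * R) : R * R * R :=
  let: (w, t1, t2) := theta in
  let s := w ^+ 2 * t2 + t1 in
  (w * t2 / s, s, t1 * t2 / s).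

(* The pushforward of the prior measure under gamma^-1 : Theta -> Theta;
   [pinv Theta gamma] is that inverse since gamma is a bijection of Theta. *)
Definition pushforward_prior (p : R * R * R -> R) :
    set (mR3 R) -> \bar R :=
  pushforward (prior_measure p) (pinv Theta gamma).

End models.

Definition independent_sequence d d' (T : measurableType d)
    (T' : measurableType d') (R : realType) (P : probability T R)
    (X : nat -> {RV P >-> T'}) : Prop :=
  forall (J : {fset nat}) (B : nat -> set T'),
    (forall i, i \in J -> measurable (B i)) ->
    P (\bigcap_(i in [set` J]) X i @^-1` B i) =
    (\prod_(i <- J) P (X i @^-1` B i))%E.

(* Main.v *)
Require Import Defs.
From HB Require Import structures.
From mathcomp Require Import all_boot all_order all_algebra finmap.
From mathcomp Require Import all_classical all_reals all_analysis.
From mathcomp Require Import measurable_realfun.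
From mathcomp Require Import ring lra.

Import Order.TTheory GRing.Theory Num.Theory.
Import numFieldNormedType.Exports.

Local Open Scope classical_set_scope.
Local Open Scope ring_scope.

(** Why the limit is what it is.

    The graphs X(2) -> X(1) and X(1) -> X(2) are Markov equivalent: theta under
    the first and gamma theta under the second give the same Gaussian density
    (model_pdf_gamma).  Substituting gamma in the evidence of S2
    (integral_gamma) turns it into the evidence of S1 under the prior
    q(theta) = p2(gamma theta) * t2 / (w^2 t2 + t1), the density of the prior
    of S2 transported by gamma^-1 (density_on_Theta_pushforward).  The ratio of
    the two evidences is therefore a ratio of integrals of q and of p1 against
    one and the same likelihood.

    That likelihood is its maximum times exp(-n K / 2), where K >= 0 depends on
    the data through the maximum likelihood estimate only and vanishes exactly
    at that estimate (likelihood_divergence).  The estimate is a continuous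
    function of the empirical second moments, hence converges almost surely to
    the true parameter by the strong law of large numbers (strong_law_nonneg).
    So the likelihood concentrates at the true parameter: off any neighbourhood
    of it the likelihood is at most e^(-n eta / 2) times the maximum, whereas
    its integral against p1 is at least of order e^(-n eta / 4) times the
    maximum (weight_concentration).  The way in which it concentrates is common
    to both integrals and cancels in their quotient: the ratio of the evidences
    tends to q / p1 at the true parameter (weighted_ratio_cvg).

    The independence model is the slice w = 0 of S1.  As the true w is not 0,
    this slice misses a neighbourhood of the true parameter, and the evidence
    of S3 is negligible (weight_independence_small). *)

Set Implicit Arguments.
Unset Strict Implicit.
Unset Printing Implicit Defensive.

(** * Lebesgue integrals: densities, affine substitutions, Tonelli in R^3 *)

Lemma measurable_invr (R : realType) : measurable_fun [set: R] (@GRing.inv R).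
Proof.
have -> : [set: R] = [set 0] `|` ~` [set 0] by rewrite setUv.
apply/measurable_funU; [exact: measurable_set1|exact: measurableC|].
split; first exact: measurable_fun_set1.
apply: subspace_continuous_measurable_fun; first exact: measurableC.
apply: continuous_in_subspaceT => x; rewrite inE /= => /eqP x0.
exact: inv_continuous.
Qed.

Section density_integral.
Context d (T : measurableType d) (R : realType).
Variables (mu nu : {measure set T -> \bar R}) (g : T -> R).
Hypotheses (mg : measurable_fun setT g) (g0 : forall x, 0 <= g x).
Hypothesis nuE : forall A, measurable A ->
  nu A = (\int[mu]_(x in A) (g x)%:E)%E.
Import HBNNSimple.

(** Simple functions reduce this to the hypothesis on sets.  Nonnegativity
    replaces integrability, so the rule may be used before an integral is known
    to be finite. *)
Lemma ge0_integral_density (f : T -> \bar R) :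
  measurable_fun setT f -> (forall x, 0 <= f x)%E ->
  (\int[nu]_x f x = \int[mu]_x (f x * (g x)%:E))%E.
Proof.
move=> mf f0.
have mEg : measurable_fun setT (EFin \o g) by exact/measurable_EFinP.
pose f_ := nnsfun_approx measurableT mf.
transitivity (limn (fun n => \int[nu]_x (f_ n x)%:E))%E.
  rewrite -monotone_convergence//.
  - apply: eq_integral => y _; apply/esym/cvg_lim => //.
    by apply: cvg_nnsfun_approx=> // *; apply: f0; rewrite inE.
  - by move=> n; exact/measurable_EFinP/measurable_funP.
  - by move=> n y _; rewrite lee_fin.
  - by move=> y _ m n mn; rewrite lee_fin; exact/lefP/nd_nnsfun_approx.
transitivity (limn (fun n => \int[mu]_x ((f_ n x)%:E * (g x)%:E)))%E; last first.
  rewrite -monotone_convergence//.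
  - apply: eq_integral => y _; apply/cvg_lim => //.
    apply: cvgeZr => //.
    by apply: cvg_nnsfun_approx=> // *; apply: f0; rewrite inE.
  - by move=> n; apply: emeasurable_funM => //; exact/measurable_EFinP/measurable_funP.
  - by move=> n y _; rewrite mule_ge0// lee_fin.
  - move=> y _ m n mn; apply: lee_wpmul2r; first by rewrite lee_fin.
    by rewrite lee_fin; exact/lefP/nd_nnsfun_approx.
congr (limn _); apply/funext => n.
under eq_integral do rewrite fimfunE -fsumEFin//.
rewrite ge0_integral_fsum//; last 2 first.
- by move=> y; exact/measurable_EFinP/measurable_funM.
- by move=> y x _; rewrite nnfun_muleindic_ge0.
have gE x : ((f_ n x)%:E * (g x)%:E = \sum_(y \in range (f_ n))
    ((y * \1_(f_ n @^-1` [set y]) x)%:E * (g x)%:E))%E.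
  rewrite fimfunE -fsumEFin// ge0_mule_fsuml// => r.
  by rewrite nnfun_muleindic_ge0.
under [RHS]eq_integral do rewrite gE.
rewrite [RHS]ge0_integral_fsum//; last 2 first.
- move=> y; apply: emeasurable_funM => //.
  exact/measurable_EFinP/measurable_funM.
- by move=> y x _; rewrite mule_ge0 ?nnfun_muleindic_ge0// lee_fin.
apply: eq_fsbigr => r _; rewrite integralZl_indic_nnsfun// integral_indic//=.
rewrite setIT.
have [r0|r0] := ltP r 0.
  have A0 : f_ n @^-1` [set r] = set0 by rewrite preimage_nnfun0.
  rewrite A0 measure0 mule0 integral0_eq// => x _.
  by rewrite indic0 mulr0 mul0e.
rewrite nuE//.
under [RHS]eq_integral do rewrite EFinM -muleA.
rewrite ge0_integralZl//; last 2 first.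
- by apply: emeasurable_funM => //; apply/measurable_EFinP.
- by move=> x _; rewrite mule_ge0 ?lee_fin// indicE.
congr (_ * _)%E; rewrite integral_mkcond epatch_indic.
by apply: eq_integral => x _; rewrite muleC.
Qed.
End density_integral.

Section lebesgue_affine.
Context {R : realType}.
Notation mu := (@lebesgue_measure R).

Lemma measurable_affine (a b : R) :
  measurable_fun setT (fun x : measurableTypeR R => a * x + b : measurableTypeR R).
Proof. by apply: measurable_funD => //; exact: measurable_funM. Qed.

Lemma affine_preimage_ocitv (a b u v : R) : 0 < a ->
  (fun x => a * x + b) @^-1` `]u, v] = `](u - b) / a, (v - b) / a]%classic.
Proof.
move=> a0; apply/seteqP; split => x /=; rewrite !in_itv/=.
  by rewrite ltr_pdivrMr// ler_pdivlMr// ltrBlDr lerBrDr mulrC.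
by rewrite ltr_pdivrMr// ler_pdivlMr// ltrBlDr lerBrDr mulrC.
Qed.

(** The image of Lebesgue measure under x |-> a x + b is a^-1 times Lebesgue
    measure, as both agree on half-open intervals. *)
Lemma ge0_integral_affine (a b : R) (f : R -> \bar R) : 0 < a ->
  measurable_fun [set: measurableTypeR R] f -> (forall x, 0 <= f x)%E ->
  (\int[mu]_x f x = \int[mu]_x (a%:E * f (a * x + b)%R))%E.
Proof.
move=> a0 mf f0.
pose phi (x : measurableTypeR R) : measurableTypeR R := a * x + b.
have mphi : measurable_fun setT phi := measurable_affine a b.
rewrite ge0_integralZl//; last exact: ltW; last exact: measurableT_comp.
rewrite -(@ge0_integral_pushforward _ _ _ _ _ phi mphi mu setT f)//.
pose aN := NngNum (ltW a0).
rewrite -(ge0_integral_mscale (pushforward mu phi) measurableT aN mf)//.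
apply: eq_measure_integral => A mA _.
apply: lebesgue_measure_unique => // _ [[u v]] _ <- /=.
rewrite /mscale/= /pushforward affine_preimage_ocitv//.
rewrite !lebesgue_measure_itv/= !lte_fin ltr_pM2r ?invr_gt0// ltrD2r.
case: ifPn => _; last by rewrite mule0.
by rewrite -EFinD -EFinM; congr EFin; field; rewrite gt_eqF.
Qed.

Lemma ge0_integral_shift (b : R) (f : R -> \bar R) :
  measurable_fun [set: measurableTypeR R] f -> (forall x, 0 <= f x)%E ->
  (\int[mu]_x f x = \int[mu]_x f (x + b)%R)%E.
Proof.
move=> mf f0; rewrite (@ge0_integral_affine 1 b)//.
by apply: eq_integral => x _; rewrite mul1e mul1r.
Qed.

End lebesgue_affine.

Section product_sigma_finite.
Context d1 d2 (T1 : measurableType d1) (T2 : measurableType d2) (R : realType).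
Variables (m1 : {sigma_finite_measure set T1 -> \bar R})
          (m2 : {sigma_finite_measure set T2 -> \bar R}).

Lemma sigma_finite_product_measure : sigma_finite setT (m1 \x m2)%E.
Proof.
have [F TF Foo] := sigma_finiteT m1; have [G TG Goo] := sigma_finiteT m2.
pose dec (n : nat) : nat * nat := odflt (0%N, 0%N) (@choice.unpickle (nat * nat)%type n).
exists (fun n => F (dec n).1 `*` G (dec n).2).
  apply/esym; rewrite -subTset => -[x y] _.
  have [i _ Fx] : (\bigcup_i F i) x by rewrite -TF.
  have [j _ Gy] : (\bigcup_i G i) y by rewrite -TG.
  by exists (choice.pickle (i, j)) => //; rewrite /dec choice.pickleK.
move=> k; have [? ?] := Foo (dec k).1; have [? ?] := Goo (dec k).2.
split; first exact: measurableX.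
by rewrite product_measure1E// lte_mul_pinfty// ge0_fin_numE.
Qed.

(** Tonelli on R^3 = R^2 x R asks for a sigma-finite structure on R^2. *)
Definition product_sigma_finite :
  {sigma_finite_measure set (T1 * T2)%type -> \bar R} :=
  HB.pack (m1 \x m2)%E (Measure_isSigmaFinite.Build _ _ _ _ sigma_finite_product_measure).
End product_sigma_finite.

Section lebesgue_fubini.
Context {R : realType}.
Let mu : {sigma_finite_measure set (measurableTypeR R) -> \bar R} :=
  lebesgue_measure.
Let mu2 : {sigma_finite_measure set (mR2 R) -> \bar R} :=
  product_sigma_finite mu mu.

Lemma lebesgue2_snd_fst (f : mR2 R -> \bar R) :
  measurable_fun setT f -> (forall x, 0 <= f x)%E ->
  (\int[lebesgue2]_z f z = \int[lebesgue_measure]_y \int[lebesgue_measure]_x f (x, y))%E.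
Proof. by move=> mf f0; exact: (@fubini_tonelli2 _ _ _ _ R mu mu f mf f0). Qed.

Lemma lebesgue2_fst_snd (f : mR2 R -> \bar R) :
  measurable_fun setT f -> (forall x, 0 <= f x)%E ->
  (\int[lebesgue2]_z f z = \int[lebesgue_measure]_x \int[lebesgue_measure]_y f (x, y))%E.
Proof. by move=> mf f0; exact: (@fubini_tonelli1 _ _ _ _ R mu mu f mf f0). Qed.

Lemma lebesgue3_trd_lebesgue2 (f : mR3 R -> \bar R) :
  measurable_fun setT f -> (forall x, 0 <= f x)%E ->
  (\int[lebesgue3]_z f z = \int[lebesgue_measure]_z \int[lebesgue2]_x f (x, z))%E.
Proof. by move=> mf f0; exact: (@fubini_tonelli2 _ _ _ _ R mu2 mu f mf f0). Qed.

Lemma lebesgue3_lebesgue2_trd (f : mR3 R -> \bar R) :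
  measurable_fun setT f -> (forall x, 0 <= f x)%E ->
  (\int[lebesgue3]_z f z = \int[lebesgue2]_x \int[lebesgue_measure]_z f (x, z))%E.
Proof. by move=> mf f0; exact: (@fubini_tonelli1 _ _ _ _ R mu2 mu f mf f0). Qed.

(** With the two lemmas that follow: a change of variable made in one coordinate,
    the others being frozen, preserves a triple integral. *)
Lemma eq_integral3_fst (f g : mR3 R -> \bar R) :
  measurable_fun setT f -> (forall x, 0 <= f x)%E ->
  measurable_fun setT g -> (forall x, 0 <= g x)%E ->
  (forall y z, \int[lebesgue_measure]_x f (x, y, z) = \int[lebesgue_measure]_x g (x, y, z))%E ->
  (\int[lebesgue3]_z f z = \int[lebesgue3]_z g z)%E.
Proof.
move=> mf f0 mg g0 fg.
rewrite (lebesgue3_trd_lebesgue2 mf f0) (lebesgue3_trd_lebesgue2 mg g0).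
apply: eq_integral => z _.
have mfz : measurable_fun setT (fun x => f (x, z)) by exact: measurable_fun_pair1.
have mgz : measurable_fun setT (fun x => g (x, z)) by exact: measurable_fun_pair1.
rewrite (lebesgue2_snd_fst mfz (fun x => f0 (x, z))) (lebesgue2_snd_fst mgz (fun x => g0 (x, z))).
by apply: eq_integral => y _; exact: fg.
Qed.

Lemma eq_integral3_snd (f g : mR3 R -> \bar R) :
  measurable_fun setT f -> (forall x, 0 <= f x)%E ->
  measurable_fun setT g -> (forall x, 0 <= g x)%E ->
  (forall x z, \int[lebesgue_measure]_y f (x, y, z) = \int[lebesgue_measure]_y g (x, y, z))%E ->
  (\int[lebesgue3]_z f z = \int[lebesgue3]_z g z)%E.
Proof.
move=> mf f0 mg g0 fg.
rewrite (lebesgue3_trd_lebesgue2 mf f0) (lebesgue3_trd_lebesgue2 mg g0).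
apply: eq_integral => z _.
have mfz : measurable_fun setT (fun x => f (x, z)) by exact: measurable_fun_pair1.
have mgz : measurable_fun setT (fun x => g (x, z)) by exact: measurable_fun_pair1.
rewrite (lebesgue2_fst_snd mfz (fun x => f0 (x, z))) (lebesgue2_fst_snd mgz (fun x => g0 (x, z))).
by apply: eq_integral => y _; exact: fg.
Qed.

Lemma eq_integral3_trd (f g : mR3 R -> \bar R) :
  measurable_fun setT f -> (forall x, 0 <= f x)%E ->
  measurable_fun setT g -> (forall x, 0 <= g x)%E ->
  (forall x y, \int[lebesgue_measure]_z f (x, y, z) = \int[lebesgue_measure]_z g (x, y, z))%E ->
  (\int[lebesgue3]_z f z = \int[lebesgue3]_z g z)%E.
Proof.
move=> mf f0 mg g0 fg.
rewrite (lebesgue3_lebesgue2_trd mf f0) (lebesgue3_lebesgue2_trd mg g0).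
by apply: eq_integral => -[x y] _; exact: fg.
Qed.

End lebesgue_fubini.

(** * Substitution by gamma in the parameter space *)

Section gamma_change_of_variables.
Context {R : realType}.
Notation mu := (@lebesgue_measure R).
Notation T3 := (mR3 R).

Lemma measurable_coord1 : measurable_fun setT (fun x : T3 => x.1.1 : R).
Proof. exact: measurableT_comp measurable_fst measurable_fst. Qed.

Lemma measurable_coord2 : measurable_fun setT (fun x : T3 => x.1.2 : R).
Proof. exact: measurableT_comp measurable_snd measurable_fst. Qed.

Lemma measurable_coord3 : measurable_fun setT (fun x : T3 => x.2 : R).
Proof. exact: measurable_snd. Qed.

Lemma measurable_fun_div d (T : measurableType d) (f g : T -> R) :
  measurable_fun setT f -> measurable_fun setT g ->
  measurable_fun setT (fun x => f x / g x).
Proof.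
move=> mf mg; apply: measurable_funM => //.
exact: measurableT_comp (@measurable_invr R) mg.
Qed.

Lemma measurable_triple d (T : measurableType d) (f g h : T -> R) :
  measurable_fun setT f -> measurable_fun setT g -> measurable_fun setT h ->
  measurable_fun setT (fun x => (f x, g x, h x) : T3).
Proof.
move=> mf mg mh.
by apply: measurable_fun_pair mh; exact: measurable_fun_pair.
Qed.

Lemma measurable_Theta : measurable (Theta : set T3).
Proof.
have -> : Theta = ((fun x : T3 => x.1.2 : R) @^-1` `]0, +oo[) `&`
                  ((fun x : T3 => x.2 : R) @^-1` `]0, +oo[).
  by apply/seteqP; split=> x /=; rewrite !in_itv/= !andbT.
apply: measurableI; rewrite -[X in measurable X]setTI.
  exact: measurable_coord2.
exact: measurable_coord3.
Qed.

(** The inverse of gamma on Theta: the formulas of gamma with the two variables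
    exchanged. *)
Definition gamma_inv (theta : R * R * R) : R * R * R :=
  let: (w, t1, t2) := theta in
  let s := w ^+ 2 * t1 + t2 in (w * t1 / s, t1 * t2 / s, s).

(** The absolute value of the determinant of the differential of gamma. *)
Definition gamma_jacobian (theta : R * R * R) : R :=
  theta.2 / (theta.1.1 ^+ 2 * theta.2 + theta.1.2).

Lemma gamma_Theta (theta : R * R * R) : Theta theta -> Theta (gamma theta).
Proof.
move: theta => [[w t1] t2] [/= t10 t20].
have s0 : 0 < w ^+ 2 * t2 + t1 by rewrite ltr_wpDl// mulr_ge0 ?sqr_ge0// ltW.
by split => //=; rewrite divr_gt0// mulr_gt0.
Qed.

Lemma gamma_inv_Theta theta : Theta theta -> Theta (gamma_inv theta).
Proof.
move: theta => [[w t1] t2] [/= t10 t20].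
have s0 : 0 < w ^+ 2 * t1 + t2 by rewrite ltr_wpDl// mulr_ge0 ?sqr_ge0// ltW.
by split => //=; rewrite divr_gt0// mulr_gt0.
Qed.

Lemma gammaK theta : Theta theta -> gamma_inv (gamma theta) = theta.
Proof.
move: theta => [[w t1] t2] [/= t10 t20].
have s0 : 0 < w ^+ 2 * t2 + t1 by rewrite ltr_wpDl// mulr_ge0 ?sqr_ge0// ltW.
rewrite /gamma_inv /gamma; set s := w ^+ 2 * t2 + t1 in s0 *.
have -> : (w * t2 / s) ^+ 2 * s + t1 * t2 / s = t2.
  transitivity (t2 * (w ^+ 2 * t2 + t1) / s); first by field; rewrite gt_eqF.
  by rewrite -/s mulfK// gt_eqF.
by congr (_, _, _); field; rewrite !gt_eqF.
Qed.

Lemma gamma_invK theta : Theta theta -> gamma (gamma_inv theta) = theta.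
Proof.
move: theta => [[w t1] t2] [/= t10 t20].
have s0 : 0 < w ^+ 2 * t1 + t2 by rewrite ltr_wpDl// mulr_ge0 ?sqr_ge0// ltW.
rewrite /gamma_inv /gamma; set s := w ^+ 2 * t1 + t2 in s0 *.
have -> : (w * t1 / s) ^+ 2 * s + t1 * t2 / s = t1.
  transitivity (t1 * (w ^+ 2 * t1 + t2) / s); first by field; rewrite gt_eqF.
  by rewrite -/s mulfK// gt_eqF.
by congr (_, _, _); field; rewrite !gt_eqF.
Qed.

Lemma measurable_gamma : measurable_fun setT (@gamma R : T3 -> T3).
Proof.
have mc1 := measurable_coord1; have mc2 := measurable_coord2.
have mc3 := measurable_coord3.
have ms : measurable_fun setT (fun x : T3 => x.1.1 ^+ 2 * x.2 + x.1.2 : R).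
  by apply: measurable_funD => //; apply: measurable_funM => //; exact: measurable_funX.
have -> : @gamma R = fun x : T3 =>
    (x.1.1 * x.2 / (x.1.1 ^+ 2 * x.2 + x.1.2), x.1.1 ^+ 2 * x.2 + x.1.2,
     x.1.2 * x.2 / (x.1.1 ^+ 2 * x.2 + x.1.2)).
  by apply/funext => -[[w t1] t2].
by apply: measurable_triple => //; apply: measurable_fun_div => //; exact: measurable_funM.
Qed.

Lemma measurable_gamma_inv : measurable_fun setT (gamma_inv : T3 -> T3).
Proof.
have mc1 := measurable_coord1; have mc2 := measurable_coord2.
have mc3 := measurable_coord3.
have ms : measurable_fun setT (fun x : T3 => x.1.1 ^+ 2 * x.1.2 + x.2 : R).
  by apply: measurable_funD => //; apply: measurable_funM => //; exact: measurable_funX.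
have -> : gamma_inv = fun x : T3 =>
    (x.1.1 * x.1.2 / (x.1.1 ^+ 2 * x.1.2 + x.2),
     x.1.2 * x.2 / (x.1.1 ^+ 2 * x.1.2 + x.2), x.1.1 ^+ 2 * x.1.2 + x.2).
  by apply/funext => -[[w t1] t2].
by apply: measurable_triple => //; apply: measurable_fun_div => //; exact: measurable_funM.
Qed.

Lemma measurable_gamma_jacobian :
  measurable_fun setT (gamma_jacobian : T3 -> R).
Proof.
have mc1 := measurable_coord1; have mc2 := measurable_coord2.
have mc3 := measurable_coord3.
apply: measurable_fun_div => //.
by apply: measurable_funD => //; apply: measurable_funM => //; exact: measurable_funX.
Qed.

Lemma gamma_jacobian_ge0 theta : Theta theta -> 0 <= gamma_jacobian theta.
Proof.
move: theta => [[w t1] t2] [/= t10 t20]; rewrite divr_ge0 ?ltW//=.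
by rewrite ltr_wpDl// mulr_ge0 ?sqr_ge0// ltW.
Qed.

Lemma ge0_integral_coord1 (f g : T3 -> \bar R) (a : R -> R -> R) :
  measurable_fun setT f -> (forall x, 0 <= f x)%E ->
  measurable_fun setT g -> (forall x, 0 <= g x)%E ->
  (forall y z, 0 < a y z -> forall x, (g (x, y, z) = (a y z)%:E * f (a y z * x, y, z)%R)%E) ->
  (forall y z, a y z <= 0 -> forall x, f (x, y, z) = 0%E /\ g (x, y, z) = 0%E) ->
  (\int[lebesgue3]_z f z = \int[lebesgue3]_z g z)%E.
Proof.
move=> mf f0 mg g0 fg fg0; apply: eq_integral3_fst => // y z.
have [a0|a0] := ltP 0 (a y z); last first.
  by apply: eq_integral => x _; have [-> ->] := fg0 _ _ a0 x.
have mfyz : measurable_fun setT (fun x : measurableTypeR R => f (x, y, z)).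
  apply: measurableT_comp mf _.
  exact: (@measurable_triple _ (measurableTypeR R) id (cst y) (cst z)).
rewrite (@ge0_integral_affine R (a y z) 0 (fun x => f (x, y, z)) a0 mfyz (fun x => f0 _)).
by apply: eq_integral => x _; rewrite addr0 fg.
Qed.

Lemma ge0_integral_coord2 (f g : T3 -> \bar R) (b : R -> R -> R) :
  measurable_fun setT f -> (forall x, 0 <= f x)%E ->
  measurable_fun setT g -> (forall x, 0 <= g x)%E ->
  (forall x y z, g (x, y, z) = f (x, y + b x z, z)) ->
  (\int[lebesgue3]_z f z = \int[lebesgue3]_z g z)%E.
Proof.
move=> mf f0 mg g0 fg; apply: eq_integral3_snd => // x z.
have mfxz : measurable_fun setT (fun y : measurableTypeR R => f (x, y, z)).
  apply: measurableT_comp mf _.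
  exact: (@measurable_triple _ (measurableTypeR R) (cst x) id (cst z)).
rewrite (@ge0_integral_shift R (b x z) (fun y => f (x, y, z)) mfxz (fun y => f0 _)).
by apply: eq_integral => y _; rewrite fg.
Qed.

Lemma ge0_integral_coord3 (f g : T3 -> \bar R) (b : R -> R -> R) :
  measurable_fun setT f -> (forall x, 0 <= f x)%E ->
  measurable_fun setT g -> (forall x, 0 <= g x)%E ->
  (forall x y z, g (x, y, z) = f (x, y, z + b x y)) ->
  (\int[lebesgue3]_z f z = \int[lebesgue3]_z g z)%E.
Proof.
move=> mf f0 mg g0 fg; apply: eq_integral3_trd => // x y.
have mfxy : measurable_fun setT (fun z : measurableTypeR R => f (x, y, z)).
  apply: measurableT_comp mf _.
  exact: (@measurable_triple _ (measurableTypeR R) (cst x) (cst y) id).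
rewrite (@ge0_integral_shift R (b x y) (fun z => f (x, y, z)) mfxy (fun z => f0 _)).
by apply: eq_integral => z _; rewrite fg.
Qed.

(** Both theta = (w, t1, t2) and gamma theta = (w', t1', t2') parametrize one
    centered Gaussian law, with covariance entries A, B, C say.  Then
    (w', t1', t2') = (B / A, A, C - B^2 / A) and
    (w, t1, t2) = (B / C, A - B^2 / C, C).  Each of these two passages is made of
    substitutions that are affine in one coordinate, with Jacobians 1 / A and C,
    whose product C / A is the Jacobian of gamma. *)
Lemma integral_gamma (F : T3 -> \bar R) :
  measurable_fun Theta F -> (forall theta, Theta theta -> 0 <= F theta)%E ->
  (\int[lebesgue3]_(theta in Theta) F theta =
   \int[lebesgue3]_(theta in Theta) (F (gamma theta) * (gamma_jacobian theta)%:E))%E.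
Proof.
move=> mF F0.
rewrite integral_mkcond [RHS]integral_mkcond.
set H := F \_ Theta.
have mH : measurable_fun setT H.
  by apply/(measurable_restrictT _ measurable_Theta).
have H0 x : (0 <= H x)%E.
  by rewrite /H patchE; case: ifPn => // /set_mem; exact: F0.
have Hout x : ~ Theta x -> H x = 0%E.
  by move=> nx; rewrite /H patchE memNset.
have mc1 := measurable_coord1; have mc2 := measurable_coord2.
have mc3 := measurable_coord3.
(* H, G, M, N and K are the integrands in the coordinates (w', A, t2'),
   (B, A, t2'), (B, A, C), (w, A, C) and (w, t1, t2); pos makes the Jacobians
   nonnegative also out of the range of the coordinates, where H vanishes. *)
pose pos (x : R) : R := Num.max x 0.
have mpos (f : T3 -> R) : measurable_fun setT f ->
    measurable_fun setT (fun x => pos (f x)).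
  by move=> mf; apply: measurable_maxr.
pose G (x : T3) : \bar R := ((pos x.1.2^-1)%:E * H (x.1.1 / x.1.2, x.1.2, x.2)%R)%E.
pose M (x : T3) : \bar R := G (x.1.1, x.1.2, x.2 - x.1.1 ^+ 2 / x.1.2).
pose N (x : T3) : \bar R := ((pos x.2)%:E * M (x.1.1 * x.2, x.1.2, x.2)%R)%E.
pose K (x : T3) : \bar R := N (x.1.1, x.1.2 + x.1.1 ^+ 2 * x.2, x.2).
have mG : measurable_fun setT G.
  apply: emeasurable_funM.
    apply/measurable_EFinP; apply: mpos.
    exact: measurableT_comp (@measurable_invr R) mc2.
  apply: measurableT_comp mH _; apply: measurable_triple => //.
  exact: measurable_fun_div.
have mM : measurable_fun setT M.
  apply: measurableT_comp mG _; apply: measurable_triple => //.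
  apply: measurable_funB => //; apply: measurable_fun_div => //.
  exact: measurable_funX.
have mN : measurable_fun setT N.
  apply: emeasurable_funM; first by apply/measurable_EFinP; exact: mpos.
  apply: measurableT_comp mM _; apply: measurable_triple => //.
  exact: measurable_funM.
have mK : measurable_fun setT K.
  apply: measurableT_comp mN _; apply: measurable_triple => //.
  apply: measurable_funD => //; apply: measurable_funM => //.
  exact: measurable_funX.
have pos0 x : 0 <= pos x by rewrite /pos le_max lexx orbT.
have posE x : 0 < x -> pos x = x by move=> x0; rewrite /pos max_l// ltW.
have G0 x : (0 <= G x)%E by rewrite mule_ge0// lee_fin.
have M0 x : (0 <= M x)%E by exact: G0.
have N0 x : (0 <= N x)%E by rewrite mule_ge0// lee_fin.
have K0 x : (0 <= K x)%E by exact: N0.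
rewrite (@ge0_integral_coord1 H G (fun y _ => pos y^-1))//; last 2 first.
- move=> y z; rewrite {1}/pos lt_max ltxx orbF invr_gt0 => y0 x.
  by rewrite /G /= posE ?invr_gt0// mulrC.
- move=> y z; rewrite {1}/pos ge_max lexx andbT invr_le0 => y0 x.
  by split; rewrite /G /= Hout ?mule0// => -[/= + _]; rewrite ltNge y0.
rewrite (@ge0_integral_coord3 G M (fun x y => - (x ^+ 2 / y)))//.
rewrite (@ge0_integral_coord1 M N (fun _ z => pos z))//; last 2 first.
- move=> y z; rewrite {1}/pos lt_max ltxx orbF => z0 x.
  by rewrite /N /= posE// mulrC.
- move=> y z; rewrite {1}/pos ge_max lexx andbT => z0 x.
  have Mx0 x' : M (x', y, z) = 0%E.
    rewrite /M /G /= Hout ?mule0// => -[/= y0].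
    rewrite subr_gt0 ltNge (le_trans z0)// divr_ge0 ?sqr_ge0// ltW//.
  by split; rewrite ?/N /= Mx0 ?mule0.
rewrite (@ge0_integral_coord2 N K (fun x z => x ^+ 2 * z))//.
apply: eq_integral => -[[w t1] t2] _.
rewrite patchE; case: ifPn => [/set_mem|/negP nT].
  move=> T0; have [/= t10 t20] := T0; have := gamma_Theta T0.
  have s0 : 0 < w ^+ 2 * t2 + t1 by rewrite ltr_wpDl// mulr_ge0 ?sqr_ge0// ltW.
  rewrite /K /N /M /G /=.
  rewrite (addrC t1) posE// posE ?invr_gt0// /gamma => gT.
  set s := w ^+ 2 * t2 + t1 in s0 gT *.
  have -> : t2 - (w * t2) ^+ 2 / s = t1 * t2 / s.
    apply: (mulIf (lt0r_neq0 s0)); rewrite mulrBl !divfK ?gt_eqF//.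
    by rewrite /s; ring.
  by rewrite /H patchE mem_set// /gamma_jacobian /= -/s muleA -EFinM muleC.
rewrite /K /N /M /G /= [H _](_ : _ = 0%E) ?mule0//.
have [t20|t20] := leP t2 0.
  rewrite Hout// => -[/= s0].
  by rewrite subr_gt0 ltNge (le_trans t20)// divr_ge0 ?sqr_ge0// ltW.
apply: Hout => -[/= s0]; rewrite subr_gt0 ltr_pdivrMr// mulrDr => h.
apply: nT; apply/mem_set; split => //=.
by move: h; rewrite exprMn -subr_gt0 (_ : _ - _ = t2 * t1) ?pmulr_rgt0//; ring.
Qed.

End gamma_change_of_variables.

(** * Uniqueness of continuous densities, and the densities of the models *)

Section density_unique.
Context d (T : measurableType d) (R : realType).
Variables (mu : {measure set T -> \bar R}) (U : set T) (nu : set T -> \bar R).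
Hypothesis mU : measurable U.

(** Such a gap on a set of positive finite measure would give that set two
    different masses. *)
Lemma density_gap_absurd (f g : T -> R) (B : set T) (a b : R) :
  is_density mu U nu f -> is_density mu U nu g ->
  measurable B -> B `<=` U -> (0 < mu B)%E -> (mu B < +oo)%E -> a < b ->
  (forall x, B x -> f x <= a) -> (forall x, B x -> b <= g x) -> False.
Proof.
move=> [mf f0 nuf] [mg g0 nug] mB BU mu0 muoo ab fa gb.
have BUE : B `&` U = B by apply/setIidPl.
have mfB : measurable_fun B (EFin \o f).
  by apply/measurable_EFinP; exact: measurable_funS mf.
have mgB : measurable_fun B (EFin \o g).
  by apply/measurable_EFinP; exact: measurable_funS mg.
have muf : mu B \is a fin_num by rewrite ge0_fin_numE.
have fleg : (\int[mu]_(x in B) (g x)%:E <= \int[mu]_(x in B) (f x)%:E)%E.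
  by move: (nuf _ mB) (nug _ mB); rewrite BUE => <- <-.
have lef : (\int[mu]_(x in B) (f x)%:E <= a%:E * mu B)%E.
  rewrite -integral_cst//; apply: ge0_le_integral => //.
  by move=> x /BU /f0; rewrite lee_fin.
have leg : (b%:E * mu B <= \int[mu]_(x in B) (g x)%:E)%E.
  rewrite -integral_cst//; apply: ge0_le_integral => //.
  move=> x Bx; rewrite lee_fin (le_trans _ (ltW ab))//.
  by rewrite (le_trans (f0 _ (BU _ Bx)) (fa _ Bx)).
have := le_trans leg (le_trans fleg lef).
by rewrite lee_pmul2r// lee_fin leNgt ab.
Qed.

(** Stated with a filter F instead of the neighbourhoods of x, since the topology
    and the sigma-algebra of R^2 and R^3 are carried by different structures. *)
Lemma density_unique_pt (F : set_system T) (x : T) (f g : T -> R) :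
  Filter F -> f @ F --> f x -> g @ F --> g x ->
  (forall Q, F Q -> exists B, [/\ measurable B, B `<=` Q, (0 < mu B)%E & (mu B < +oo)%E]) ->
  F U -> is_density mu U nu f -> is_density mu U nu g -> f x = g x.
Proof.
move=> FF; wlog fg : f g / f x <= g x.
  move=> wl cf cg FB FU df dg; have [/wl|/ltW /wl] := leP (f x) (g x).
    by apply.
  by move=> h; apply/esym/h.
move=> cf cg FB FU df dg; apply/eqP; rewrite eq_le fg/= leNgt; apply/negP => fltg.
pose a := (2 * f x + g x) / 3; pose b := (f x + 2 * g x) / 3.
have fa : f x < a by rewrite /a; lra.
have bg : b < g x by rewrite /b; lra.
have ab : a < b by rewrite /a /b; lra.
have Ff : F [set y | f y < a] by exact: (cvgr_lt _ cf).
have Fg : F [set y | b < g y] by exact: (cvgr_gt _ cg).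
have [B [mB BQ mu0 muoo]] := FB _ (filterI (filterI Ff Fg) FU).
apply: (density_gap_absurd df dg mB _ mu0 muoo ab).
- by move=> y /BQ[].
- by move=> y /BQ[[/ltW]].
- by move=> y /BQ[[_ /ltW]].
Qed.

End density_unique.

Section boxes.
Context {R : realType}.
Notation mu := (@lebesgue_measure R).

Definition box2 (x : R * R) (e : R) : set (mR2 R) := ball x.1 e `*` ball x.2 e.

Definition box3 (x : R * R * R) (e : R) : set (mR3 R) :=
  (ball x.1.1 e `*` ball x.1.2 e) `*` ball x.2 e.

Lemma measurable_box2 x e : measurable (box2 x e).
Proof. by apply: measurableX; exact: measurable_ball. Qed.

Lemma measurable_box3 x e : measurable (box3 x e).
Proof. by apply: measurableX; [exact: measurable_box2|exact: measurable_ball]. Qed.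

Lemma lebesgue2_box x (e : R) : 0 <= e -> lebesgue2 (box2 x e) = ((e *+ 2) ^+ 2)%:E.
Proof.
move=> e0.
transitivity (mu (ball x.1 e) * mu (ball x.2 e))%E.
  by apply: product_measure1E; exact: measurable_ball.
by rewrite !lebesgue_measure_ball.
Qed.

Lemma lebesgue3_box x (e : R) : 0 <= e -> lebesgue3 (box3 x e) = ((e *+ 2) ^+ 3)%:E.
Proof.
move=> e0.
transitivity (lebesgue2 (box2 x.1 e) * mu (ball x.2 e))%E.
  by apply: product_measure1E; [exact: measurable_box2|exact: measurable_ball].
by rewrite (lebesgue2_box _ e0) (lebesgue_measure_ball _ e0) [in RHS]exprSr EFinM.
Qed.

Lemma nbhs_box2 (x : R * R) (Q : set (R * R)) : nbhs x Q ->
  exists2 e, 0 < e & box2 x e `<=` Q.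
Proof. by move=> /nbhs_ballP[e /= e0 eQ]; exists e => // y [? ?]; apply: eQ. Qed.

Lemma nbhs_box3 (x : R * R * R) (Q : set (R * R * R)) : nbhs x Q ->
  exists2 e, 0 < e & box3 x e `<=` Q.
Proof.
by move=> /nbhs_ballP[e /= e0 eQ]; exists e => // y [[? ?] ?]; apply: eQ.
Qed.

Lemma lebesgue2_nbhs (x : R * R) (Q : set (mR2 R)) : nbhs x Q ->
  exists B, [/\ measurable B, B `<=` Q, (0 < lebesgue2 B)%E & (lebesgue2 B < +oo)%E].
Proof.
move=> /nbhs_box2[e e0 eQ]; exists (box2 x e).
split=> //; first exact: measurable_box2.
- by rewrite lebesgue2_box ?ltW// lte_fin exprn_gt0// mulrn_wgt0.
- by rewrite lebesgue2_box ?ltW// ltry.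
Qed.

Lemma lebesgue3_nbhs (x : R * R * R) (Q : set (mR3 R)) : nbhs x Q ->
  exists B, [/\ measurable B, B `<=` Q, (0 < lebesgue3 B)%E & (lebesgue3 B < +oo)%E].
Proof.
move=> /nbhs_box3[e e0 eQ]; exists (box3 x e).
split=> //; first exact: measurable_box3.
- by rewrite lebesgue3_box ?ltW// lte_fin exprn_gt0// mulrn_wgt0.
- by rewrite lebesgue3_box ?ltW// ltry.
Qed.

Lemma nbhs_Theta (theta : R * R * R) : Theta theta -> nbhs theta Theta.
Proof.
move: theta => [[w t1] t2] [/= t10 t20].
have h1 : nbhs (w, t1, t2) [set y : R * R * R | 0 < y.1.2].
  have c : (fun y : R * R * R => y.1.2) @ (w, t1, t2) --> t1.
    by apply: (cvg_comp (fst : R * R * R -> R * R) snd); [exact: cvg_fst|exact: cvg_snd].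
  exact: (cvgr_gt _ c).
have h2 : nbhs (w, t1, t2) [set y : R * R * R | 0 < y.2].
  have c : (snd : R * R * R -> R) @ (w, t1, t2) --> t2 by exact: cvg_snd.
  exact: (cvgr_gt _ c).
by apply: filterS (filterI h1 h2) => y [].
Qed.

End boxes.

Section gaussian_density.
Context {R : realType}.
Notation mu := (@lebesgue_measure R).
Notation gauss t := (normal_pdf 0 (Num.sqrt t)).
Notation N t := (normal_prob 0 (Num.sqrt t)).

Definition noise_measure (t1 t2 : R) : {measure set (mR2 R) -> \bar R} :=
  (N t1 \x N t2)%E.

Definition pdf2 (t1 t2 : R) (x : R * R) : R := gauss t1 x.1 * gauss t2 x.2.

Lemma measurable_pdf2 t1 t2 : measurable_fun setT (pdf2 t1 t2 : mR2 R -> R).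
Proof.
apply: measurable_funM.
  exact: measurableT_comp (@measurable_normal_pdf R 0 (Num.sqrt t1)) measurable_fst.
exact: measurableT_comp (@measurable_normal_pdf R 0 (Num.sqrt t2)) measurable_snd.
Qed.

Lemma pdf2_ge0 t1 t2 x : 0 <= pdf2 t1 t2 x.
Proof. by rewrite mulr_ge0// normal_pdf_ge0. Qed.

Lemma ge0_integral_normal (m s : R) (f : measurableTypeR R -> \bar R) :
  measurable_fun setT f -> (forall x, 0 <= f x)%E ->
  (\int[normal_prob m s]_x f x = \int[mu]_x (f x * (normal_pdf m s x)%:E))%E.
Proof.
move=> mf f0; apply: ge0_integral_density => //.
- exact: measurable_normal_pdf.
- exact: normal_pdf_ge0.
Qed.

Lemma ge0_integral_noise (t1 t2 : R) (F : mR2 R -> \bar R) :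
  measurable_fun setT F -> (forall x, 0 <= F x)%E ->
  (\int[noise_measure t1 t2]_x F x = \int[lebesgue2]_x (F x * (pdf2 t1 t2 x)%:E))%E.
Proof.
move=> mF F0.
have mg t : measurable_fun setT (fun x : measurableTypeR R => (gauss t x)%:E).
  by apply/measurable_EFinP; exact: measurable_normal_pdf.
rewrite lebesgue2_fst_snd; last 2 first.
- apply: emeasurable_funM => //; apply/measurable_EFinP; exact: measurable_pdf2.
- by move=> x; rewrite mule_ge0// lee_fin pdf2_ge0.
transitivity (\int[N t1]_x \int[N t2]_y F (x, y))%E.
  exact: (@fubini_tonelli1 _ _ _ _ R (N t1) (N t2) F mF F0).
rewrite ge0_integral_normal; last 2 first.
- exact: (measurable_fun_fubini_tonelli_F F).
- by move=> x; apply: integral_ge0.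
apply: eq_integral => x _; rewrite /fubini_F.
have mFx : measurable_fun setT (fun y => F (x, y)) by exact: measurable_fun_pair2.
rewrite ge0_integral_normal// -ge0_integralZr//; last 3 first.
- exact: emeasurable_funM.
- by move=> y _; rewrite mule_ge0// lee_fin normal_pdf_ge0.
- by rewrite lee_fin normal_pdf_ge0.
by apply: eq_integral => y _; rewrite /pdf2/= EFinM -muleA [(_%:E * (gauss t2 _)%:E)%E]muleC.
Qed.

Lemma measurable_structural S (w : R) : measurable_fun setT (structural S w : mR2 R -> mR2 R).
Proof.
case: S => /=; last exact: measurable_id.
- apply: measurable_fun_pair; last exact: measurable_snd.
  apply: measurable_funD; last exact: measurable_fst.
  by apply: measurable_funM => //; exact: measurable_snd.
- apply: measurable_fun_pair; first exact: measurable_fst.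
  apply: measurable_funD; last exact: measurable_snd.
  by apply: measurable_funM => //; exact: measurable_fst.
Qed.

(** The noise that produces the observation x. *)
Definition unmix (S : structure) (w : R) (x : R * R) : R * R :=
  match S with
  | S1 => (x.1 - w * x.2, x.2)
  | S2 => (x.1, x.2 - w * x.1)
  | S3 => x
  end.

Lemma structuralK S (w : R) : cancel (structural S w) (unmix S w).
Proof. by case: S => -[x y] //=; rewrite [w * _ + _]addrC addrK. Qed.

Lemma measurable_unmix S (w : R) : measurable_fun setT (unmix S w : mR2 R -> mR2 R).
Proof.
case: S => /=; last exact: measurable_id.
- apply: measurable_fun_pair; last exact: measurable_snd.
  apply: measurable_funB; first exact: measurable_fst.
  by apply: measurable_funM => //; exact: measurable_snd.
- apply: measurable_fun_pair; first exact: measurable_fst.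
  apply: measurable_funB; first exact: measurable_snd.
  by apply: measurable_funM => //; exact: measurable_fst.
Qed.

(** The structural map is a shear, or the identity. *)
Lemma ge0_integral_structural S (w : R) (F : mR2 R -> \bar R) :
  measurable_fun setT F -> (forall x, 0 <= F x)%E ->
  (\int[lebesgue2]_e F (structural S w e) = \int[lebesgue2]_x F x)%E.
Proof.
move=> mF F0; case: S => //.
- have mF' : measurable_fun setT (fun e : mR2 R => F (structural S1 w e)).
    exact: measurableT_comp mF (measurable_structural S1 w).
  rewrite (lebesgue2_snd_fst mF' (fun=> F0 _)) (lebesgue2_snd_fst mF F0).
  apply: eq_integral => y _.
  have mFy : measurable_fun setT (fun x : measurableTypeR R => F (x, y)).
    exact: measurable_fun_pair1.
  rewrite (@ge0_integral_shift R (w * y) (fun x => F (x, y)) mFy (fun=> F0 _)).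
  by apply: eq_integral => x _ /=; rewrite addrC.
- have mF' : measurable_fun setT (fun e : mR2 R => F (structural S2 w e)).
    exact: measurableT_comp mF (measurable_structural S2 w).
  rewrite (lebesgue2_fst_snd mF' (fun=> F0 _)) (lebesgue2_fst_snd mF F0).
  apply: eq_integral => x _.
  have mFx : measurable_fun setT (fun y : measurableTypeR R => F (x, y)).
    exact: measurable_fun_pair2.
  rewrite (@ge0_integral_shift R (w * x) (fun y => F (x, y)) mFx (fun=> F0 _)).
  by apply: eq_integral => y _ /=; rewrite addrC.
Qed.

Definition model_pdf (S : structure) (theta : R * R * R) (x : R * R) : R :=
  pdf2 theta.1.2 theta.2 (unmix S theta.1.1 x).

Lemma measurable_model_pdf S theta :
  measurable_fun setT (model_pdf S theta : mR2 R -> R).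
Proof. exact: measurableT_comp (measurable_pdf2 _ _) (measurable_unmix _ _). Qed.

(** Shears preserve Lebesgue measure, so the density at x is the density of the
    noise that produces x. *)
Lemma law_density S (theta : R * R * R) :
  is_density lebesgue2 setT (law S theta) (model_pdf S theta).
Proof.
have mp := measurable_model_pdf S theta.
split=> //; first by move=> x _; exact: pdf2_ge0.
move=> A mA; rewrite setIT.
have mEA : measurable_fun setT (fun x : mR2 R => ((\1_A x : R)%:E)).
  by apply/measurable_EFinP; exact: measurable_indic.
have mSA : measurable (structural S theta.1.1 @^-1` A).
  by rewrite -[X in measurable X]setTI; exact: (measurable_structural S theta.1.1).
have -> : law S theta A = (\int[noise_measure theta.1.2 theta.2]_x
    (\1_(structural S theta.1.1 @^-1` A) x)%:E)%E.
  rewrite (@integral_indic _ _ _ (noise_measure theta.1.2 theta.2) _ measurableT _ mSA).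
  by rewrite setIT.
rewrite ge0_integral_noise//; last first.
  by apply/measurable_EFinP; exact: measurable_indic.
rewrite [RHS]integral_mkcond epatch_indic.
rewrite -[RHS](@ge0_integral_structural S theta.1.1); last 2 first.
- by apply: emeasurable_funM; [exact/measurable_EFinP|exact: mEA].
- by move=> x; rewrite mule_ge0 ?lee_fin ?pdf2_ge0.
apply: eq_integral => e _; rewrite muleC /model_pdf structuralK.
by congr (_ * _)%E; rewrite !indicE /=; congr ((nat_of_bool _)%:R%:E); apply/idP/idP;
  rewrite !inE.
Qed.

Lemma continuous_model_pdf S theta : Theta theta -> continuous (model_pdf S theta).
Proof.
move=> [t10 t20] x; have s1 : Num.sqrt theta.1.2 != 0 by rewrite gt_eqF// sqrtr_gt0.
have s2 : Num.sqrt theta.2 != 0 by rewrite gt_eqF// sqrtr_gt0.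
have c1 : {for x, continuous (fun x => (unmix S theta.1.1 x).1)}.
  case: S => /=; [|exact: cvg_fst|exact: cvg_fst].
  apply: cvgB; first exact: cvg_fst.
  by apply: cvgM; [exact: cvg_cst|exact: cvg_snd].
have c2 : {for x, continuous (fun x => (unmix S theta.1.1 x).2)}.
  case: S c1 => /= _; [exact: cvg_snd| |exact: cvg_snd].
  apply: cvgB; first exact: cvg_snd.
  by apply: cvgM; [exact: cvg_cst|exact: cvg_fst].
apply: cvgM.
  by apply: (cvg_comp _ (gauss theta.1.2)) c1 _; exact: continuous_normal_pdf.
by apply: (cvg_comp _ (gauss theta.2)) c2 _; exact: continuous_normal_pdf.
Qed.

Lemma densityE S theta : Theta theta -> density S theta = model_pdf S theta.
Proof.
move=> T0.
have exd : [set f : R * R -> R | continuous f /\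
    is_density lebesgue2 setT (law S theta) f] (model_pdf S theta).
  by split; [exact: continuous_model_pdf|exact: law_density].
have [cd dd] := getPex (ex_intro _ _ exd).
apply/funext => x; apply: (@density_unique_pt _ (mR2 R) R lebesgue2 setT _ measurableT
  (nbhs (x : R * R))); [exact: cd|exact: continuous_model_pdf| |exact: filterT|exact: dd|
  exact: law_density].
exact: lebesgue2_nbhs.
Qed.

End gaussian_density.

(** * The prior of S2 transported by the inverse of gamma *)

Section transported_prior.
Context {R : realType}.
Notation T3 := (mR3 R).

(** The prior density p carried from S2 to S1 by the inverse of gamma. *)
Definition transported_prior (p : R * R * R -> R) (theta : R * R * R) : R :=
  p (gamma theta) * gamma_jacobian theta.

Lemma measurable_transported_prior (p : R * R * R -> R) :
  measurable_fun (Theta : set T3) p ->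
  measurable_fun (Theta : set T3) (transported_prior p).
Proof.
move=> mp; apply: measurable_funM; last first.
  exact: measurable_funTS measurable_gamma_jacobian.
apply: (measurable_comp (measurable_Theta (R := R)) _ mp).
  by move=> _ [theta T0 <-]; exact: gamma_Theta.
exact: measurable_funTS measurable_gamma.
Qed.

Lemma transported_prior_ge0 (p : R * R * R -> R) :
  (forall theta, Theta theta -> 0 <= p theta) ->
  forall theta, Theta theta -> 0 <= transported_prior p theta.
Proof.
move=> p0 theta T0; rewrite mulr_ge0//; first exact/p0/gamma_Theta.
exact: gamma_jacobian_ge0.
Qed.

Lemma pinv_gamma (theta : R * R * R) :
  Theta theta -> pinv Theta gamma theta = gamma_inv theta.
Proof.
move=> T0; rewrite -{1}(gamma_invK T0) pinvKV//; last first.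
  by rewrite inE; exact: gamma_inv_Theta.
move=> x y /set_mem Tx /set_mem Ty /(congr1 gamma_inv).
by rewrite !gammaK.
Qed.

Lemma pushforward_prior_density (p : R * R * R -> R) :
  measurable_fun (Theta : set T3) p ->
  (forall theta, Theta theta -> 0 <= p theta) ->
  is_density lebesgue3 (Theta : set T3) (pushforward_prior p)
    (transported_prior p).
Proof.
move=> mp p0; split.
- exact: measurable_transported_prior.
- exact: transported_prior_ge0.
move=> A mA; rewrite /pushforward_prior /pushforward /prior_measure.
have mdA : measurable (gamma_inv @^-1` A : set T3).
  by rewrite -[X in measurable X]setTI; exact: measurable_gamma_inv.
have -> : pinv Theta gamma @^-1` A `&` Theta = Theta `&` (gamma_inv @^-1` A) :> set T3.
  rewrite setIC; apply/seteqP; split => x [Tx /=].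
    by rewrite pinv_gamma.
  by move=> Ax; split => //=; rewrite pinv_gamma.
rewrite [in RHS]setIC integral_mkcondr [RHS]integral_mkcondr integral_gamma; last 2 first.
- apply/(measurable_restrict _ mdA (measurable_Theta (R := R))).
  apply: measurable_funS (measurable_Theta (R := R)) (@subIsetl _ _ _) _.
  exact/measurable_EFinP.
- by move=> theta T0; rewrite patchE; case: ifPn => // _; rewrite lee_fin p0.
apply: eq_integral => theta /set_mem T0; rewrite !patchE.
have -> : (gamma theta \in gamma_inv @^-1` A) = (theta \in A).
  by apply/idP/idP; rewrite !inE /= gammaK.
by case: ifPn => _; rewrite ?mul0e// /transported_prior EFinM.
Qed.

Lemma integral_transported_prior (p L : R * R * R -> R) :
  measurable_fun (Theta : set T3) p -> measurable_fun (Theta : set T3) L ->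
  (forall theta, Theta theta -> 0 <= p theta) ->
  (forall theta, Theta theta -> 0 <= L theta) ->
  (\int[lebesgue3]_(theta in Theta) (L theta * p theta)%:E =
   \int[lebesgue3]_(theta in Theta)
     (L (gamma theta) * transported_prior p theta)%:E)%E.
Proof.
move=> mp mL p0 L0; rewrite integral_gamma.
- by apply: eq_integral => theta _; rewrite -EFinM /transported_prior mulrA.
- by apply/measurable_EFinP; exact: measurable_funM.
- by move=> theta T0; rewrite lee_fin mulr_ge0// ?L0 ?p0.
Qed.

Lemma continuous_gamma (theta : R * R * R) : Theta theta ->
  {for theta, continuous (@gamma R)} /\ {for theta, continuous (@gamma_jacobian R)}.
Proof.
move: theta => [[w t1] t2] T0; have [/= t10 t20] := T0.
have s0 : w ^+ 2 * t2 + t1 != 0.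
  by rewrite gt_eqF// ltr_wpDl// mulr_ge0 ?sqr_ge0// ltW.
have c1 : (fun x : R * R * R => x.1.1) @ (w, t1, t2) --> w.
  by apply: (cvg_comp (fst : R * R * R -> R * R) fst); exact: cvg_fst.
have c2 : (fun x : R * R * R => x.1.2) @ (w, t1, t2) --> t1.
  by apply: (cvg_comp (fst : R * R * R -> R * R) snd); [exact: cvg_fst|exact: cvg_snd].
have c3 : (fun x : R * R * R => x.2) @ (w, t1, t2) --> t2 by exact: cvg_snd.
have cs : (fun x : R * R * R => x.1.1 ^+ 2 * x.2 + x.1.2) @ (w, t1, t2) -->
    w ^+ 2 * t2 + t1.
  apply: cvgD => //; apply: cvgM => //.
  by rewrite expr2; under eq_fun do rewrite expr2; exact: cvgM.
have cV : (fun x : R * R * R => (x.1.1 ^+ 2 * x.2 + x.1.2)^-1) @ (w, t1, t2) -->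
    (w ^+ 2 * t2 + t1)^-1 by exact: cvgV.
split; last by apply: cvgM c3 cV.
have -> : @gamma R = fun x : R * R * R =>
    (x.1.1 * x.2 / (x.1.1 ^+ 2 * x.2 + x.1.2), x.1.1 ^+ 2 * x.2 + x.1.2,
     x.1.2 * x.2 / (x.1.1 ^+ 2 * x.2 + x.1.2)).
  by apply/funext => -[[? ?] ?].
have d1 : (fun x : R * R * R => x.1.1 * x.2 / (x.1.1 ^+ 2 * x.2 + x.1.2))
    @ (w, t1, t2) --> w * t2 / (w ^+ 2 * t2 + t1) by apply: cvgM cV; exact: cvgM.
have d3 : (fun x : R * R * R => x.1.2 * x.2 / (x.1.1 ^+ 2 * x.2 + x.1.2))
    @ (w, t1, t2) --> t1 * t2 / (w ^+ 2 * t2 + t1) by apply: cvgM cV; exact: cvgM.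
exact: (cvg_pair (cvg_pair d1 cs) d3).
Qed.

Lemma continuous_transported_prior (p : R * R * R -> R) (theta : R * R * R) :
  Theta theta -> {for gamma theta, continuous p} ->
  {for theta, continuous (transported_prior p)}.
Proof.
move=> T0 cp; have [cg cj] := continuous_gamma T0.
have cpg : (fun x => p (gamma x)) @ theta --> p (gamma theta).
  exact: (cvg_comp (@gamma R) p cg cp).
exact: cvgM cpg cj.
Qed.

Lemma times_differentiable_continuous k (V : normedModType R) (U : set V) (f : V -> R) x :
  times_differentiable k.+1 U f -> U x -> {for x, continuous f}.
Proof. by move=> [df _] Ux; exact/differentiable_continuous/df. Qed.

Lemma density_on_Theta_pushforward (p : R * R * R -> R) (theta : R * R * R) :
  measurable_fun (Theta : set T3) p ->
  (forall theta, Theta theta -> 0 <= p theta) ->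
  (forall theta, Theta theta -> {for theta, continuous p}) ->
  Theta theta ->
  density_on_Theta (pushforward_prior p) theta = transported_prior p theta.
Proof.
move=> mp p0 cp T0.
have ct th : Theta th -> {for th, continuous (transported_prior p)}.
  by move=> Tth; apply: continuous_transported_prior => //; exact/cp/gamma_Theta.
have dt := pushforward_prior_density mp p0.
have exd : [set f : R * R * R -> R |
    (forall th, Theta th -> {for th, continuous f}) /\
    is_density lebesgue3 Theta (pushforward_prior p) f] (transported_prior p).
  by split.
have [cd dd] := getPex (ex_intro _ _ exd).
apply: (@density_unique_pt _ T3 R lebesgue3 Theta _ (measurable_Theta (R := R))
  (nbhs (theta : R * R * R))).
- exact: cd.
- exact: ct.
- exact: lebesgue3_nbhs.
- exact: nbhs_Theta.
- exact: dd.
- exact: dt.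
Qed.

End transported_prior.

(** * Strong law of large numbers *)

Section interpolation.
Context {R : realType}.

Definition isqrt (n : nat) : nat := Num.truncn (Num.sqrt (n%:R : R)).

Lemma isqrt_le n : ((isqrt n) ^ 2 <= n)%N.
Proof.
rewrite -(ler_nat R) natrX -[leRHS](@sqr_sqrtr R)// lerXn2r ?nnegrE ?sqrtr_ge0//.
by have /andP[] := truncn_itv (sqrtr_ge0 (n%:R : R)).
Qed.

Lemma isqrt_gt n : (n < (isqrt n).+1 ^ 2)%N.
Proof.
rewrite -(ltr_nat R) natrX -[ltLHS](@sqr_sqrtr R)// ltrXn2r ?nnegrE ?sqrtr_ge0//.
by have /andP[] := truncn_itv (sqrtr_ge0 (n%:R : R)).
Qed.

Lemma cvg_isqrt : isqrt n @[n --> \oo] --> \oo.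
Proof.
apply/cvgnyPge => A; exists (A ^ 2)%N => // n /= An.
by rewrite -ltnS -(@ltn_exp2r _ _ 2)// (leq_ltn_trans An)// isqrt_gt.
Qed.

(** If k^2 <= n < (k + 1)^2 then S n / n lies between S (k^2) / (k + 1)^2 and
    S ((k + 1)^2) / k^2 by monotonicity, and (k + 1)^2 / k^2 tends to 1. *)
Lemma cvg_average_of_squares (S : nat -> R) (m : R) :
  (forall n, 0 <= S n) -> {homo S : a b / (a <= b)%N >-> a <= b} ->
  S (k ^ 2)%N / (k ^ 2)%:R @[k --> \oo] --> m ->
  S n / n%:R @[n --> \oo] --> m.
Proof.
move=> S0 Sle cS.
pose r (k : nat) : R := (k.+1%:R / k%:R) ^+ 2.
have cr : r k @[k --> \oo] --> (1 : R).
  rewrite -(cvg_shiftS r) -[1](expr1n _ 2) /r.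
  have c1 : (k.+2%:R / k.+1%:R : R) @[k --> \oo] --> (1 : R).
    have -> : (fun k => k.+2%:R / k.+1%:R : R) = (fun k => 1 + k.+1%:R^-1).
      apply/funext => k; rewrite -[k.+2]addn1 natrD mulrDl divff ?mul1r//.
    by rewrite -[X in _ --> X]addr0; apply: cvgD; [exact: cvg_cst|exact: cvg_harmonic].
  by rewrite expr2; under eq_fun do rewrite expr2; exact: cvgM.
pose u (k : nat) : R := S (k ^ 2)%N / (k ^ 2)%:R.
have clow : u (isqrt n) / r (isqrt n) @[n --> \oo] --> m.
  apply: (cvg_comp isqrt (fun k => u k / r k) cvg_isqrt).
  rewrite -[m]divr1; apply: cvgM => //.
  by apply: cvgV; rewrite ?oner_eq0.
have cup : u (isqrt n).+1 * r (isqrt n) @[n --> \oo] --> m.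
  apply: (cvg_comp isqrt (fun k => u k.+1 * r k) cvg_isqrt).
  rewrite -[m]mulr1; apply: cvgM => //.
  by rewrite (cvg_shiftS u).
apply: (squeeze_cvgr _ clow cup).
exists 1%N => // n /= n0.
have k0 : (0 < isqrt n)%N.
  by rewrite lt0n; apply/eqP => k0; have := isqrt_gt n; rewrite k0 ltnS leqNgt n0.
have kR : (0 : R) < (isqrt n)%:R by rewrite ltr0n.
have nR : (0 : R) < n%:R by rewrite ltr0n.
apply/andP; split.
- have -> : u (isqrt n) / r (isqrt n) = S (isqrt n ^ 2)%N / ((isqrt n).+1 ^ 2)%:R.
    by rewrite /u /r !natrX; field; rewrite ?gt_eqF//= ltr0n.
  rewrite ler_pdivrMr ?ltr0n ?expn_gt0// mulrAC ler_pdivlMr//.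
  apply: ler_pM => //; first exact/Sle/isqrt_le.
  by rewrite ler_nat ltnW// isqrt_gt.
- have -> : u (isqrt n).+1 * r (isqrt n) = S ((isqrt n).+1 ^ 2)%N / (isqrt n ^ 2)%:R.
    by rewrite /u /r !natrX; field; rewrite ?gt_eqF//= ltr0n.
  rewrite ler_pdivrMr// mulrAC ler_pdivlMr ?ltr0n ?expn_gt0 ?k0//.
  apply: ler_pM => //; last by rewrite ler_nat isqrt_le.
  by apply: Sle; rewrite ltnW// isqrt_gt.
Qed.

End interpolation.

(** Comparison with the telescoping series of 2 / ((k + 1) (k + 2)). *)
Lemma sum_inv_sqr_le (R : realType) n :
  \sum_(0 <= k < n) ((k.+1%:R ^+ 2)^-1 : R) <= 2 * (1 - n.+1%:R^-1).
Proof.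
elim: n => [|n IH]; first by rewrite big_geq// invr1 subrr mulr0.
rewrite big_nat_recr//= (le_trans (lerD IH (lexx _)))//.
have n1 : (0 : R) < n.+1%:R by rewrite ltr0n.
have n2 : (0 : R) < n.+2%:R by rewrite ltr0n.
rewrite -subr_ge0.
have -> : 2 * (1 - n.+2%:R^-1) - (2 * (1 - n.+1%:R^-1) + (n.+1%:R ^+ 2)^-1) =
   n%:R / (n.+1%:R ^+ 2 * n.+2%:R) :> R.
  have -> : n.+2%:R = n%:R + 2 :> R by rewrite -addn2 natrD.
  have -> : n.+1%:R = n%:R + 1 :> R by rewrite -addn1 natrD.
  by field; rewrite -!natr1 in n1 n2 *; lra.
by rewrite divr_ge0// mulr_ge0// exprn_ge0.
Qed.

Section strong_law.
Context d (T : measurableType d) (R : realType) (P : probability T R).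

Lemma ge0_integralD_EFin (f g : T -> R) :
  measurable_fun setT f -> measurable_fun setT g ->
  (forall x, 0 <= f x) -> (forall x, 0 <= g x) ->
  (\int[P]_x (f x + g x)%:E = \int[P]_x (f x)%:E + \int[P]_x (g x)%:E)%E.
Proof.
move=> mf mg f0 g0; rewrite -ge0_integralD//.
- by move=> x _; rewrite lee_fin.
- exact/measurable_EFinP.
- by move=> x _; rewrite lee_fin.
- exact/measurable_EFinP.
Qed.

Lemma ge0_integralZl_EFinr (f : T -> R) (c : R) :
  measurable_fun setT f -> (forall x, 0 <= f x) -> 0 <= c ->
  (\int[P]_x (c * f x)%:E = c%:E * \int[P]_x (f x)%:E)%E.
Proof.
move=> mf f0 c0; rewrite -ge0_integralZl//; first exact/measurable_EFinP.
by move=> x _; rewrite lee_fin.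
Qed.

(** The sum of the Z k has a finite integral, hence is almost surely finite, and
    the terms of a convergent series tend to 0. *)
Lemma ae_cvg0_of_summable (Z : nat -> T -> R) (c : R) :
  (forall k, measurable_fun setT (Z k)) -> (forall k x, 0 <= Z k x) ->
  (forall n, \sum_(0 <= k < n) \int[P]_x (Z k x)%:E <= c%:E)%E ->
  {ae P, forall x, Z k x @[k --> \oo] --> (0 : R)}.
Proof.
move=> mZ Z0 Zc.
pose W x := (\sum_(k <oo) (Z k x)%:E)%E.
have mW : measurable_fun setT W.
  by apply: ge0_emeasurable_sum => // k *; [rewrite lee_fin|exact/measurable_EFinP].
have W0 x : (0 <= W x)%E by apply: nneseries_ge0 => *; rewrite lee_fin.
have WE : (\int[P]_x W x <= c%:E)%E.
  rewrite integral_nneseries//; last 2 first.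
  - by move=> k; exact/measurable_EFinP.
  - by move=> k x _; rewrite lee_fin.
  apply: lime_le.
    by apply: is_cvg_nneseries => *; apply: integral_ge0 => *; rewrite lee_fin.
  by apply: nearW => n; exact: Zc.
have iW : P.-integrable setT W.
  apply/integrableP; split => //.
  under eq_integral do rewrite gee0_abs//.
  by rewrite (le_lt_trans WE)// ltry.
have := integrable_ae measurableT iW.
apply: filterS => x /(_ I) Wfin.
apply: cvg_series_cvg_0.
apply: nondecreasing_is_cvgn.
  by apply: nondecreasing_series => *.
exists (fine (W x)) => _ [n _ <-].
rewrite -lee_fin fineK// /series/= -sumEFin.
apply: nneseries_lim_ge => *; by rewrite lee_fin.
Qed.

Variables (Y : nat -> T -> R) (m v : R).
Hypothesis mY : forall i, measurable_fun setT (Y i).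
Hypothesis Y0 : forall i x, 0 <= Y i x.
Hypothesis EY : forall i, (\int[P]_x (Y i x)%:E = m%:E)%E.
Hypothesis EYY : forall i j, i != j -> (\int[P]_x (Y i x * Y j x)%:E = (m * m)%:E)%E.
Hypothesis EY2 : forall i, (\int[P]_x (Y i x * Y i x)%:E = v%:E)%E.

Let S n x := \sum_(i < n) Y i x.

Let mS n : measurable_fun setT (S n).
Proof. exact: measurable_sum. Qed.

Let SS n x : S n.+1 x = S n x + Y n x.
Proof. exact: big_ord_recr. Qed.

Let S0 n x : 0 <= S n x.
Proof. exact: sumr_ge0. Qed.

Let m0 : 0 <= m.
Proof. by rewrite -lee_fin -(EY 0%N); apply: integral_ge0 => x _; rewrite lee_fin. Qed.

Let ES n : (\int[P]_x (S n x)%:E = (n%:R * m)%:E)%E.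
Proof.
elim: n => [|n IH].
  rewrite mul0r; under eq_integral do rewrite /S big_ord0.
  by rewrite integral0.
under eq_integral do rewrite SS.
by rewrite ge0_integralD_EFin// IH EY -EFinD -natr1 mulrDl mul1r.
Qed.

Let ESY n j : (n <= j)%N -> (\int[P]_x (S n x * Y j x)%:E = (n%:R * (m * m))%:E)%E.
Proof.
elim: n => [|n IH] nj.
  rewrite mul0r; under eq_integral do rewrite /S big_ord0 mul0r.
  by rewrite integral0.
under eq_integral do rewrite SS mulrDl.
rewrite ge0_integralD_EFin//.
- by rewrite IH ?(ltnW nj)// EYY ?ltn_eqF// -EFinD -natr1 mulrDl mul1r.
- exact: measurable_funM.
- exact: measurable_funM.
- by move=> x; rewrite mulr_ge0.
- by move=> x; rewrite mulr_ge0.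
Qed.

Let ES2 n : (\int[P]_x (S n x * S n x)%:E =
  (n%:R * v + n%:R * (n%:R - 1) * (m * m))%:E)%E.
Proof.
elim: n => [|n IH].
  rewrite !mul0r addr0; under eq_integral do rewrite /S big_ord0 mul0r.
  by rewrite integral0.
transitivity (\int[P]_x (S n x * S n x + (2 * (S n x * Y n x) + Y n x * Y n x))%:E)%E.
  apply: eq_integral => x _; rewrite SS; congr EFin; ring.
have mSS : measurable_fun setT (fun x => S n x * S n x) by exact: measurable_funM.
have mSY : measurable_fun setT (fun x => S n x * Y n x) by exact: measurable_funM.
have mYY : measurable_fun setT (fun x => Y n x * Y n x) by exact: measurable_funM.
have m2SY : measurable_fun setT (fun x => 2 * (S n x * Y n x)) by exact: measurable_funM.
have SY0 x : 0 <= S n x * Y n x by rewrite mulr_ge0.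
have SY20 x : 0 <= 2 * (S n x * Y n x) by rewrite mulr_ge0.
have YY0 x : 0 <= Y n x * Y n x by rewrite mulr_ge0.
rewrite ge0_integralD_EFin//; last 3 first.
- exact: measurable_funD.
- by move=> x; rewrite mulr_ge0.
- by move=> x; rewrite addr_ge0.
rewrite ge0_integralD_EFin// ge0_integralZl_EFinr// IH ESY// EY2.
by rewrite -EFinM -!EFinD -natr1; congr EFin; ring.
Qed.

Let ESc n : (\int[P]_x ((S n x - n%:R * m) ^+ 2)%:E = (n%:R * (v - m * m))%:E)%E.
Proof.
have mc : measurable_fun setT (fun x => (S n x - n%:R * m) ^+ 2).
  by apply: measurable_funX; exact: measurable_funB.
have c0 : 0 <= 2 * (n%:R * m) by rewrite !mulr_ge0.
have h : (\int[P]_x ((S n x - n%:R * m) ^+ 2)%:E +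
    (2 * (n%:R * m) * (n%:R * m))%:E =
    (n%:R * v + n%:R * (n%:R - 1) * (m * m))%:E + ((n%:R * m) ^+ 2)%:E)%E.
  rewrite [in LHS]EFinM -ES -ES2 -ge0_integralZl_EFinr//.
  have -> : (((n%:R * m) ^+ 2)%:E = \int[P]_x ((n%:R * m) ^+ 2)%:E)%E.
    by rewrite integral_cst//= probability_setT mule1.
  rewrite -!ge0_integralD_EFin//.
  - by apply: eq_integral => x _; congr EFin; ring.
  - exact: measurable_funM.
  - by move=> x; rewrite mulr_ge0.
  - by move=> x; exact: sqr_ge0.
  - exact: measurable_funM.
  - by move=> x; rewrite sqr_ge0.
  - by move=> x; rewrite mulr_ge0.
have := h; move/eqP; rewrite -EFinD eq_sym -sube_eq//; last exact: fin_num_adde_defl.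
by rewrite -EFinB => /eqP <-; congr EFin; ring.
Qed.

(** The average of the first n terms has variance (v - m^2) / n, which is summable
    along n = k^2; this gives almost sure convergence along the squares, and
    nonnegativity of the terms fills the gaps. *)
Lemma strong_law_nonneg :
  {ae P, forall x, (\sum_(i < n) Y i x) / n%:R @[n --> \oo] --> m}.
Proof.
pose Z k x := ((S (k.+1 ^ 2)%N x - (k.+1 ^ 2)%:R * m) / (k.+1 ^ 2)%:R) ^+ 2.
have mZ k : measurable_fun setT (Z k).
  by apply: measurable_funX; apply: measurable_funM => //; exact: measurable_funB.
have Z0 k x : 0 <= Z k x by exact: sqr_ge0.
have EZ k : (\int[P]_x (Z k x)%:E = ((v - m * m) * (k.+1%:R ^+ 2)^-1)%:E)%E.
  transitivity (\int[P]_x ((((k.+1 ^ 2)%:R ^+ 2)^-1) *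
      (S (k.+1 ^ 2)%N x - (k.+1 ^ 2)%:R * m) ^+ 2)%:E)%E.
    by apply: eq_integral => x _; rewrite /Z exprMn exprVn mulrC.
  rewrite ge0_integralZl_EFinr ?ESc//.
  - rewrite -EFinM natrX; congr EFin.
    have : (k.+1%:R : R) != 0 by rewrite pnatr_eq0.
    by move: (k.+1%:R : R) => a a0; field.
  - by apply: measurable_funX; exact: measurable_funB.
  - by move=> x; exact: sqr_ge0.
have vm0 : 0 <= v - m * m.
  have : (0 <= (1%:R * (v - m * m))%:E)%E.
    by rewrite -ESc; apply: integral_ge0 => x _; rewrite lee_fin sqr_ge0.
  by rewrite lee_fin mul1r.
have sumZ n : (\sum_(0 <= k < n) \int[P]_x (Z k x)%:E <= ((v - m * m) * 2)%:E)%E.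
  under eq_bigr do rewrite EZ.
  rewrite sumEFin lee_fin -mulr_sumr ler_wpM2l//.
  by rewrite (le_trans (sum_inv_sqr_le R n))// ler_piMr// gerBl.
have := ae_cvg0_of_summable mZ Z0 sumZ.
apply: filterS => x cZ.
apply: (@cvg_average_of_squares R (S ^~ x) m) => //.
  by apply/nondecreasing_seqP => n; rewrite SS lerDl.
have cA : (S (k.+1 ^ 2)%N x - (k.+1 ^ 2)%:R * m) / (k.+1 ^ 2)%:R @[k --> \oo] --> (0 : R).
  apply/norm_cvg0P.
  have -> : (fun k => `|(S (k.+1 ^ 2)%N x - (k.+1 ^ 2)%:R * m) / (k.+1 ^ 2)%:R|) =
      fun k => Num.sqrt (Z k x).
    by apply/funext => k; rewrite /Z sqrtr_sqr.
  by rewrite -[X in _ --> X](@sqrtr0 R); apply: (cvg_comp (Z ^~ x)) cZ _; exact: sqrt_continuous.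
rewrite -(cvg_shiftS (fun k => S (k ^ 2)%N x / (k ^ 2)%:R)).
rewrite -[m]add0r.
have -> : (fun k => S (k.+1 ^ 2)%N x / (k.+1 ^ 2)%:R) =
  (fun k => (S (k.+1 ^ 2)%N x - (k.+1 ^ 2)%:R * m) / (k.+1 ^ 2)%:R + m).
  by apply/funext => k; rewrite mulrBl mulrAC divff ?mul1r ?subrK// pnatr_eq0 expn_eq0.
by apply: cvgD => //; exact: cvg_cst.
Qed.

End strong_law.

Section independence.
Context d (T : measurableType d) (R : realType) (P : probability T R).
Context d' (T' : measurableType d') (X : nat -> {RV P >-> T'}).

(** Independence says that the joint law of X i and X j agrees with the product
    of their laws on rectangles, hence everywhere; then Tonelli applies. *)
Lemma independent_integralM (f g : T' -> \bar R) i j : independent_sequence X ->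
  i != j ->
  measurable_fun setT f -> (forall x, 0 <= f x)%E ->
  measurable_fun setT g -> (forall x, 0 <= g x)%E ->
  (\int[P]_x (f (X i x) * g (X j x)) =
   \int[P]_x f (X i x) * \int[P]_x g (X j x))%E.
Proof.
move=> indep ij mf f0 mg g0.
pose XX (x : T) : T' * T' := (X i x, X j x).
have mXX : measurable_fun setT XX by exact: measurable_fun_pair.
have PXX A : measurable A ->
    (distribution P (X i) \x distribution P (X j))%E A = pushforward P XX A.
  apply: (@product_measure_unique _ _ T' T' R (distribution P (X i))
    (distribution P (X j)) (pushforward P XX)) => A1 A2 mA1 mA2.
  pose B k := if k == i then A1 else A2.
  have := indep [fset i; j]%fset B.
  rewrite big_fsetU1/= ?inE// big_seq_fset1 /B eqxx eq_sym (negbTE ij) => <-; last first.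
    by move=> k _; case: ifP.
  congr (P _); apply/seteqP; split => x /=.
    move=> [Ax1 Ax2] k /=; rewrite !inE => /orP[/eqP ->|/eqP ->].
      by rewrite eqxx.
    by rewrite eq_sym (negbTE ij).
  move=> h; split.
    by have := h i; rewrite /= !inE eqxx => /(_ isT).
  by have := h j; rewrite /= !inE eqxx orbT eq_sym (negbTE ij) => /(_ isT).
pose F (z : T' * T') := (f z.1 * g z.2)%E.
have mF : measurable_fun setT F.
  apply: emeasurable_funM; first exact: measurableT_comp mf measurable_fst.
  exact: measurableT_comp mg measurable_snd.
have F0 z : (0 <= F z)%E by rewrite mule_ge0.
transitivity (\int[pushforward P XX]_z F z)%E.
  by rewrite ge0_integral_pushforward.
transitivity (\int[(distribution P (X i) \x distribution P (X j))]_z F z)%E.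
  by apply: eq_measure_integral => A mA _; exact/esym/PXX.
rewrite fubini_tonelli1//.
transitivity (\int[distribution P (X i)]_x (f x * \int[distribution P (X j)]_y g y))%E.
  by apply: eq_integral => x _; rewrite -ge0_integralZl.
rewrite ge0_integralZr//; last exact: integral_ge0.
by rewrite !ge0_integral_distribution.
Qed.

End independence.

(** * Moments of centered Gaussian variables *)

Section gaussian_moments.
Context {R : realType}.
Notation mu := (@lebesgue_measure R).
Notation gauss t := (normal_pdf 0 (Num.sqrt t)).
Notation N t := (normal_prob 0 (Num.sqrt t)).

Lemma is_derive_gauss_fun (x : R) :
  is_derive x (1 : R) (fun y : R => - gauss_fun y) (2 * x * gauss_fun x).
Proof.
rewrite /gauss_fun; apply: is_derive_eq.
by rewrite !scaler1; ring.
Qed.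

Lemma continuous_x_gauss : continuous (fun x : R => 2 * x * gauss_fun x).
Proof.
move=> x; apply: cvgM; last exact: continuous_gauss_fun.
by apply: cvgM; [exact: cvg_cst|exact: cvg_id].
Qed.

Lemma gauss_tail (y : R) : 0 <= y ->
  (\int[mu]_(x in `]y, +oo[) (2 * x * gauss_fun x)%:E = (gauss_fun y)%:E)%E.
Proof.
move=> y0; rewrite integral_itv_obnd_cbnd; last first.
  apply/measurable_EFinP/measurable_funTS.
  by apply: continuous_measurable_fun; exact: continuous_x_gauss.
rewrite (@ge0_continuous_FTC2y R _ (fun x => - gauss_fun x) y 0).
- by rewrite sub0e -EFinN opprK.
- by move=> x yx; rewrite !mulr_ge0 ?gauss_fun_ge0// (le_trans y0).
- by apply: continuous_subspaceT; exact: continuous_x_gauss.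
- by rewrite -oppr0; apply: cvgN; exact: cvg_gauss_fun.
- by move=> x _; exact: (@ex_derive _ _ _ _ _ _ _ (is_derive_gauss_fun x)).
- by apply: cvg_at_right_filter; apply: cvgN; exact: continuous_gauss_fun.
- by move=> x _; rewrite derive1E (@derive_val _ _ _ _ _ _ _ (is_derive_gauss_fun x)).
Qed.

(** Write 2 x^2 e^(-x^2) as the integral over y in [0, x[ of 2 x e^(-x^2) and
    exchange the integrals: the inner one becomes the Gaussian tail integral,
    which is e^(-y^2), and the integral of the latter is known. *)
Lemma integral0y_sqr_gauss :
  (\int[mu]_(x in [set x | (0 <= x)%R]) (x ^+ 2 * gauss_fun x)%:E =
   (Num.sqrt pi / 4)%:E)%E.
Proof.
pose A : set (mR2 R) := [set z | 0 <= z.2 /\ z.2 < z.1].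
have mA : measurable A.
  have -> : A = ((snd : mR2 R -> R) @^-1` `[0, +oo[) `&`
      ((fun z : mR2 R => z.1 - z.2 : R) @^-1` `]0, +oo[).
    by apply/seteqP; split => z /=; rewrite !in_itv/= !andbT subr_gt0.
  apply: measurableI; rewrite -[X in measurable X]setTI.
    exact: (@measurable_snd _ _ (measurableTypeR R) (measurableTypeR R)).
  have : measurable_fun setT (fun z : mR2 R => z.1 - z.2 : R).
    by apply: measurable_funB; [exact: measurable_fst|exact: measurable_snd].
  by apply.
have mx : measurable_fun setT (fun x : measurableTypeR R => 2 * x * gauss_fun x).
  by apply: continuous_measurable_fun; exact: continuous_x_gauss.
pose k (z : mR2 R) : \bar R := ((\1_A z : R)%:E * (2 * `|z.1| * gauss_fun z.1)%:E)%E.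
have mk : measurable_fun setT k.
  apply: emeasurable_funM; first by apply/measurable_EFinP; exact: measurable_indic.
  apply/measurable_EFinP; apply: measurable_funM.
    apply: measurable_funM => //.
    by apply: measurableT_comp (@normr_measurable R setT) _; exact: measurable_fst.
  exact: measurableT_comp (@measurable_gauss_fun R) measurable_fst.
have k0 z : (0 <= k z)%E.
  by rewrite mule_ge0 ?lee_fin// ?indicE// !mulr_ge0 ?gauss_fun_ge0.
have := lebesgue2_snd_fst mk k0; rewrite (lebesgue2_fst_snd mk k0).
have -> : (\int[mu]_x \int[mu]_y k (x, y) =
    2%:E * \int[mu]_(x in [set x | (0 <= x)%R]) (x ^+ 2 * gauss_fun x)%:E)%E.
  rewrite -ge0_integralZl//; last 3 first.
  - by rewrite -set_itvcy.
  - apply/measurable_EFinP/measurable_funTS; apply: measurable_funM.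
      exact: measurable_funX.
    exact: measurable_gauss_fun.
  - by move=> x _; rewrite lee_fin mulr_ge0 ?sqr_ge0 ?gauss_fun_ge0.
  rewrite [RHS]integral_mkcond; apply: eq_integral => x _.
  rewrite patchE; case: ifPn => [/set_mem x0|/negP nx].
    transitivity (\int[mu]_y ((2 * x * gauss_fun x)%:E * (\1_`[0, x[%classic y)%:E))%E.
      apply: eq_integral => y _; rewrite /k /= muleC ger0_norm//; congr (_ * _%:E)%E.
      rewrite !indicE; congr (nat_of_bool _)%:R; apply/idP/idP; rewrite !inE /= in_itv/=.
        by move=> [-> ->].
      by move=> /andP[y0 yx]; split.
    rewrite ge0_integralZl//; last 2 first.
    - by apply/measurable_EFinP; exact: measurable_indic.
    - by rewrite lee_fin !mulr_ge0 ?gauss_fun_ge0.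
    rewrite integral_indic//= setIT lebesgue_measure_itv/= lte_fin.
    move: x0; rewrite /= le_eqVlt => /predU1P[<-|x0].
      by rewrite ltxx !mulr0 mul0r mule0 expr0n/= mul0r mule0.
    by rewrite x0 -EFinB -!EFinM subr0; congr EFin; ring.
  rewrite integral0_eq// => y _; rewrite /k indicE memNset ?mul0e// => -[/= y0 yx].
  by apply: nx; rewrite inE /= (le_trans y0)// ltW.
have -> : (\int[mu]_y \int[mu]_x k (x, y) = (Num.sqrt pi / 2)%:E)%E.
  rewrite -integral0y_gauss [RHS]integral_mkcond; apply: eq_integral => y _.
  rewrite patchE; case: ifPn => [/set_mem|/negP ny].
    rewrite /= in_itv/= andbT => y0; rewrite -gauss_tail// [RHS]integral_mkcond.
    apply: eq_integral => x _; rewrite patchE /k indicE.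
    case: ifPn => [/set_mem|/negP nx].
      rewrite /= in_itv/= andbT => yx.
      by rewrite mem_set ?mul1e// ger0_norm// (le_trans y0)// ltW.
    rewrite memNset ?mul0e// => -[/= _ yx].
    by apply: nx; rewrite inE /= in_itv/= yx.
  rewrite integral0_eq// => x _; rewrite /k indicE memNset ?mul0e// => -[/= y0 _].
  by apply: ny; rewrite inE /= in_itv/= y0.
have I0 : (0 <= \int[mu]_(x in [set x | (0 <= x)%R]) (x ^+ 2 * gauss_fun x)%:E)%E.
  by apply: integral_ge0 => x _; rewrite lee_fin mulr_ge0 ?sqr_ge0 ?gauss_fun_ge0.
move: I0; case: (\int[mu]_(x in _) _)%E => [r _|_|//].
  by rewrite -EFinM => -[h]; congr EFin; apply: (mulfI (x := 2)) => //; rewrite h; field.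
by rewrite mulry gtr0_sg// mul1e.
Qed.

Lemma integralT_sqr_gauss :
  (\int[mu]_x (x ^+ 2 * gauss_fun x)%:E = (Num.sqrt pi / 2)%:E)%E.
Proof.
rewrite ge0_symfun_integralT.
- by rewrite integral0y_sqr_gauss -EFinM; congr EFin; field.
- by move=> x; rewrite mulr_ge0 ?sqr_ge0 ?gauss_fun_ge0.
- move=> x; apply: cvgM; last exact: continuous_gauss_fun.
  exact: exprn_continuous.
- by move=> x /=; rewrite /gauss_fun !sqrrN.
Qed.

Lemma normal_pdf_sqrt (t x : R) : 0 < t ->
  gauss t x = (Num.sqrt (2 * pi * t))^-1 * expR (- (x ^+ 2 / (2 * t))).
Proof.
move=> t0; rewrite normal_pdfE ?gt_eqF ?sqrtr_gt0// /normal_peak /normal_fun.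
rewrite sqr_sqrtr ?ltW// subr0; congr (_ * expR _).
  by congr (Num.sqrt _)^-1; rewrite -mulr_natl; ring.
by rewrite mulNr -[t *+ 2]mulr_natl.
Qed.

Lemma measurable_pow_gauss (t : R) n :
  measurable_fun setT (fun x : measurableTypeR R => (x ^+ n * gauss t x)%:E).
Proof.
apply/measurable_EFinP; apply: measurable_funM; last exact: measurable_normal_pdf.
exact: measurable_funX.
Qed.

Lemma normal_second_moment (t : R) : 0 < t ->
  (\int[mu]_x (x ^+ 2 * gauss t x)%:E = t%:E)%E.
Proof.
move=> t0; set a := Num.sqrt (2 * t).
have a0 : 0 < a by rewrite sqrtr_gt0 mulr_gt0.
have a2 : a ^+ 2 = 2 * t by rewrite sqr_sqrtr// mulr_ge0// ltW.
have pi0 : 0 < Num.sqrt pi :> R by rewrite sqrtr_gt0 pi_gt0.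
rewrite (@ge0_integral_affine R a 0 _ a0 (@measurable_pow_gauss t 2)); last first.
  by move=> x; rewrite lee_fin mulr_ge0 ?sqr_ge0 ?normal_pdf_ge0.
transitivity (\int[mu]_x ((a ^+ 2 / Num.sqrt pi)%:E * (x ^+ 2 * gauss_fun x)%:E))%E.
  apply: eq_integral => x _; rewrite -!EFinM addr0 normal_pdf_sqrt// /gauss_fun.
  have -> : 2 * pi * t = (2 * t) * pi by ring.
  rewrite sqrtrM ?mulr_ge0 ?ltW// -/a exprMn a2.
  have -> : 2 * t * x ^+ 2 / (2 * t) = x ^+ 2 by field; rewrite gt_eqF.
  by congr EFin; field; rewrite !gt_eqF.
rewrite ge0_integralZl//; last 3 first.
- apply/measurable_EFinP; apply: measurable_funM; first exact: measurable_funX.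
  exact: measurable_gauss_fun.
- by move=> x _; rewrite lee_fin mulr_ge0 ?sqr_ge0 ?gauss_fun_ge0.
- by rewrite lee_fin divr_ge0 ?sqr_ge0// ltW.
by rewrite integralT_sqr_gauss -EFinM a2; congr EFin; field; rewrite gt_eqF.
Qed.

(** Up to a constant, x^4 e^(-x^2 / 2 t) is below e^(-x^2 / 4 t), a multiple of
    the normal density of variance 2 t. *)
Lemma normal_fourth_moment_lty (t : R) : 0 < t ->
  (\int[mu]_x (x ^+ 4 * gauss t x)%:E < +oo)%E.
Proof.
move=> t0.
have t20 : 0 < 2 * t by rewrite mulr_gt0.
pose c := Num.sqrt (2 * pi * (2 * t)) / Num.sqrt (2 * pi * t) * (64 * t ^+ 2).
have c0 : 0 <= c by rewrite mulr_ge0 ?divr_ge0 ?sqrtr_ge0// mulr_ge0 ?sqr_ge0.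
apply: (@le_lt_trans _ _ (\int[mu]_x (c%:E * (gauss (2 * t) x)%:E))%E).
  apply: ge0_le_integral => //.
  - by move=> x _; rewrite lee_fin mulr_ge0 ?normal_pdf_ge0// (exprM _ 2 2) sqr_ge0.
  - exact: measurable_pow_gauss.
  - by apply/measurable_EFinP; apply: measurable_funM => //; exact: measurable_normal_pdf.
  move=> x _; rewrite -EFinM lee_fin !normal_pdf_sqrt// /c.
  set y := x ^+ 2 / (4 * t).
  have y0 : 0 <= y by rewrite divr_ge0 ?sqr_ge0// mulr_ge0// ltW.
  have -> : x ^+ 2 / (2 * (2 * t)) = y by rewrite /y; congr (_ / _); ring.
  have -> : x ^+ 2 / (2 * t) = y + y by rewrite /y; field; rewrite gt_eqF.
  have -> : x ^+ 4 = 16 * t ^+ 2 * y ^+ 2 by rewrite /y; field; rewrite gt_eqF.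
  have p1 : 0 < Num.sqrt (2 * pi * (2 * t)) by rewrite sqrtr_gt0 !mulr_gt0 ?pi_gt0.
  have p2 : 0 < Num.sqrt (2 * pi * t) by rewrite sqrtr_gt0 !mulr_gt0 ?pi_gt0.
  have ye : y ^+ 2 * expR (- y) <= 4.
    rewrite expRN ler_pdivrMr ?expR_gt0//.
    have -> : y = y / 2 + y / 2 by field.
    rewrite expRD -[_ + _]/(y / 2 + y / 2).
    have h : 1 + y / 2 <= expR (y / 2) by exact: expR_ge1Dx.
    have h0 : 0 <= 1 + y / 2 by rewrite addr_ge0// divr_ge0.
    have hh := ler_pM h0 h0 h h.
    rewrite -ler_pdivrMl//; apply: le_trans hh.
    rewrite -subr_ge0 (_ : _ - _ = 1 + y); last by field.
    by rewrite addr_ge0.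
  rewrite opprD expRD.
  have -> : 16 * t ^+ 2 * y ^+ 2 * ((Num.sqrt (2 * pi * t))^-1 * (expR (- y) * expR (- y))) =
    16 * t ^+ 2 * (Num.sqrt (2 * pi * t))^-1 * expR (- y) * (y ^+ 2 * expR (- y)) by ring.
  have -> : Num.sqrt (2 * pi * (2 * t)) / Num.sqrt (2 * pi * t) * (64 * t ^+ 2) *
     ((Num.sqrt (2 * pi * (2 * t)))^-1 * expR (- y)) =
     16 * t ^+ 2 * (Num.sqrt (2 * pi * t))^-1 * expR (- y) * 4.
    by field; rewrite !gt_eqF.
  apply: ler_wpM2l => //.
  rewrite mulr_ge0 ?expR_ge0// divr_ge0 ?(ltW p2)//.
  by rewrite mulr_ge0 ?sqr_ge0.
rewrite ge0_integralZl//; last 2 first.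
- by apply/measurable_EFinP; exact: measurable_normal_pdf.
- by move=> x _; rewrite lee_fin normal_pdf_ge0.
by rewrite integral_normal_pdf mule1 ltry.
Qed.

Lemma ge0_integral_opp (f : R -> \bar R) :
  measurable_fun [set: measurableTypeR R] f -> (forall x, 0 <= f x)%E ->
  (\int[mu]_x f x = \int[mu]_x f (- x)%R)%E.
Proof.
move=> mf f0.
pose phi (x : measurableTypeR R) : measurableTypeR R := - x.
have mphi : measurable_fun setT phi by exact: oppr_measurable.
rewrite -[RHS](@ge0_integral_pushforward _ _ _ _ _ phi mphi mu setT f)//.
by apply: eq_measure_integral => A mA _; exact/esym/lebesgue_measureN.
Qed.

Lemma ge0_integral_normal_opp (t : R) (f : R -> \bar R) : 0 < t ->
  measurable_fun [set: measurableTypeR R] f -> (forall x, 0 <= f x)%E ->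
  (\int[N t]_x f x = \int[N t]_x f (- x)%R)%E.
Proof.
move=> t0 mf f0.
have mfN : measurable_fun [set: measurableTypeR R] (fun x => f (- x)).
  by apply: (measurableT_comp mf); exact: oppr_measurable.
have mg : measurable_fun setT (fun x : measurableTypeR R => (gauss t x)%:E).
  by apply/measurable_EFinP; exact: measurable_normal_pdf.
rewrite !ge0_integral_normal// ge0_integral_opp; last 2 first.
- exact: emeasurable_funM.
- by move=> x; rewrite mule_ge0 ?lee_fin ?normal_pdf_ge0.
by apply: eq_integral => x _; rewrite !normal_pdf_sqrt// sqrrN.
Qed.

Lemma ge0_integralN_D (t : R) (f g : R -> R) :
  measurable_fun setT f -> measurable_fun setT g ->
  (forall x, 0 <= f x) -> (forall x, 0 <= g x) ->
  (\int[N t]_x (f x + g x)%:E = \int[N t]_x (f x)%:E + \int[N t]_x (g x)%:E)%E.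
Proof. exact: (@ge0_integralD_EFin _ (measurableTypeR R) R (N t)). Qed.

Lemma ge0_integralN_Zl (t : R) (f : R -> R) (c : R) :
  measurable_fun setT f -> (forall x, 0 <= f x) -> 0 <= c ->
  (\int[N t]_x (c * f x)%:E = c%:E * \int[N t]_x (f x)%:E)%E.
Proof. exact: (@ge0_integralZl_EFinr _ (measurableTypeR R) R (N t)). Qed.

Lemma integralN_cst (t c : R) : (\int[N t]_x c%:E = c%:E)%E.
Proof. by rewrite integral_cst//= probability_setT mule1. Qed.

Lemma integralN_sqr (t : R) : 0 < t -> (\int[N t]_x (x ^+ 2)%:E = t%:E)%E.
Proof.
move=> t0; rewrite ge0_integral_normal.
- by under eq_integral do rewrite -EFinM; rewrite normal_second_moment.
- by apply/measurable_EFinP; exact: measurable_funX.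
- by move=> x; rewrite lee_fin sqr_ge0.
Qed.

Lemma integralN_pow4_lty (t : R) : 0 < t -> (\int[N t]_x (x ^+ 4)%:E < +oo)%E.
Proof.
move=> t0; rewrite ge0_integral_normal.
- by under eq_integral do rewrite -EFinM; exact: normal_fourth_moment_lty.
- by apply/measurable_EFinP; exact: measurable_funX.
- by move=> x; rewrite lee_fin (exprM _ 2 2) sqr_ge0.
Qed.

(** By symmetry of the law the integral is unchanged by a |-> - a.  The mean of the
    two integrands is a^2 x^2 + c^2: the odd moment, and with it any integral of
    a signed function, is avoided. *)
Lemma integralN_affine_sqr (t a c : R) : 0 < t ->
  (\int[N t]_x ((a * x + c) ^+ 2)%:E = (a ^+ 2 * t + c ^+ 2)%:E)%E.
Proof.
move=> t0.
have mpq a' : measurable_fun setT (fun x : R => (a' * x + c) ^+ 2).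
  by apply: measurable_funX; apply: measurable_funD => //; exact: measurable_funM.
set I := (\int[N t]_x _)%E.
have I0 : (0 <= I)%E by apply: integral_ge0 => x _; rewrite lee_fin sqr_ge0.
have II : (I + I = (2 * (a ^+ 2 * t + c ^+ 2))%:E)%E.
  rewrite {2}/I (@ge0_integral_normal_opp t (fun x => ((a * x + c) ^+ 2)%:E))//; last 2 first.
  - by apply/measurable_EFinP; exact: mpq.
  - by move=> x; rewrite lee_fin sqr_ge0.
  under [X in (_ + X)%E]eq_integral do rewrite mulrN -mulNr.
  rewrite /I -ge0_integralN_D//; last 2 first.
  - by move=> x; exact: sqr_ge0.
  - by move=> x; exact: sqr_ge0.
  transitivity (\int[N t]_x (2 * a ^+ 2 * x ^+ 2 + 2 * c ^+ 2)%:E)%E.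
    by apply: eq_integral => x _; congr EFin; ring.
  rewrite ge0_integralN_D//; last 3 first.
  - by apply: measurable_funM => //; exact: measurable_funX.
  - by move=> x; rewrite mulr_ge0 ?sqr_ge0// mulr_ge0 ?sqr_ge0.
  - by move=> x; rewrite mulr_ge0 ?sqr_ge0.
  rewrite ge0_integralN_Zl//; last 2 first.
  - by move=> x; exact: sqr_ge0.
  - by rewrite mulr_ge0 ?sqr_ge0.
  rewrite integralN_sqr// integralN_cst -EFinM -EFinD; congr EFin; ring.
move: I0 II; case: I => [r _|_|//].
  by rewrite -EFinD => -[h]; congr EFin; lra.
by [].
Qed.

Lemma noise_fubini (t1 t2 : R) (F : mR2 R -> \bar R) :
  measurable_fun setT F -> (forall x, 0 <= F x)%E ->
  (\int[noise_measure t1 t2]_x F x = \int[N t2]_y \int[N t1]_x F (x, y))%E.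
Proof.
by move=> mF F0; exact: (@fubini_tonelli2 _ _ _ _ R (N t1) (N t2) F mF F0).
Qed.

Lemma measurable_lin2 (a b : R) n :
  measurable_fun setT (fun e : mR2 R => (a * e.1 + b * e.2) ^+ n : R).
Proof.
by apply: measurable_funX; apply: measurable_funD; apply: measurable_funM => //.
Qed.

Lemma noise_sqr (t1 t2 a b : R) : 0 < t1 -> 0 < t2 ->
  (\int[noise_measure t1 t2]_e ((a * e.1 + b * e.2) ^+ 2)%:E =
   (a ^+ 2 * t1 + b ^+ 2 * t2)%:E)%E.
Proof.
move=> t10 t20; rewrite noise_fubini; last 2 first.
- by apply/measurable_EFinP; exact: measurable_lin2.
- by move=> x; rewrite lee_fin sqr_ge0.
under eq_integral do rewrite /= integralN_affine_sqr//.
rewrite ge0_integralN_D//; last 3 first.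
- by apply: measurable_funX; exact: measurable_funM.
- by move=> x; rewrite mulr_ge0 ?sqr_ge0// ltW.
- by move=> x; exact: sqr_ge0.
rewrite integralN_cst.
have := @integralN_affine_sqr t2 b 0 t20.
by under eq_integral do rewrite addr0; move=> ->; rewrite expr0n addr0 -EFinD.
Qed.

Lemma noise_pow4_lty (t1 t2 a b : R) : 0 < t1 -> 0 < t2 ->
  (\int[noise_measure t1 t2]_e ((a * e.1 + b * e.2) ^+ 4)%:E < +oo)%E.
Proof.
move=> t10 t20; rewrite noise_fubini; last 2 first.
- by apply/measurable_EFinP; exact: measurable_lin2.
- by move=> x; rewrite lee_fin (exprM _ 2 2) sqr_ge0.
have pow40 (x : R) : 0 <= x ^+ 4 by rewrite (exprM _ 2 2) sqr_ge0.
have fin4 (t : R) : 0 < t -> exists r, (\int[N t]_x (x ^+ 4)%:E = r%:E)%E.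
  move=> t0; have := integralN_pow4_lty t0.
  have : (0 <= \int[N t]_x (x ^+ 4)%:E)%E by apply: integral_ge0 => x _; rewrite lee_fin.
  by case: (\int[N t]_x _)%E => // r _ _; exists r.
have [m1 M1] := fin4 _ t10; have [m2 M2] := fin4 _ t20.
have m10 : 0 <= m1.
  by rewrite -lee_fin -M1; apply: integral_ge0 => x _; rewrite lee_fin.
apply: (@le_lt_trans _ _ (\int[N t2]_y (8 * a ^+ 4 * m1 + 8 * b ^+ 4 * y ^+ 4)%:E)%E).
  apply: ge0_le_integral => //.
  - by move=> y _; apply: integral_ge0 => x _; rewrite lee_fin.
  - have mF : measurable_fun setT (fun e : mR2 R => ((a * e.1 + b * e.2) ^+ 4)%:E).
      by apply/measurable_EFinP; exact: measurable_lin2.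
    have F0 (e : mR2 R) : (0 <= ((a * e.1 + b * e.2) ^+ 4)%:E)%E by rewrite lee_fin.
    exact: (@measurable_fun_fubini_tonelli_G _ _ _ _ R (N t1) _ mF F0).
  - apply/measurable_EFinP; apply: measurable_funD => //.
    by apply: measurable_funM => //; exact: measurable_funX.
  move=> y _.
  apply: (@le_trans _ _ (\int[N t1]_x (8 * a ^+ 4 * x ^+ 4 + 8 * b ^+ 4 * y ^+ 4)%:E)%E).
    apply: ge0_le_integral => //.
    - by move=> x _; rewrite lee_fin.
    - apply/measurable_EFinP; apply: measurable_funX => /=.
      by apply: measurable_funD => //; exact: measurable_funM.
    - apply/measurable_EFinP; apply: measurable_funD => //.
      by apply: measurable_funM => //; exact: measurable_funX.
    move=> x _ /=; rewrite lee_fin.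
    set u := a * x; set v := b * y.
    have -> : 8 * a ^+ 4 * x ^+ 4 + 8 * b ^+ 4 * y ^+ 4 = 8 * (u ^+ 4 + v ^+ 4).
      by rewrite /u /v; ring.
    rewrite -subr_ge0.
    have -> : 8 * (u ^+ 4 + v ^+ 4) - (u + v) ^+ 4 =
       (u - v) ^+ 2 * ((u - v) ^+ 2 + 6 * (u + v) ^+ 2) by ring.
    by rewrite mulr_ge0 ?sqr_ge0// addr_ge0 ?sqr_ge0// mulr_ge0 ?sqr_ge0.
  rewrite ge0_integralN_D//; last 3 first.
  - by apply: measurable_funM => //; exact: measurable_funX.
  - by move=> x; rewrite mulr_ge0// mulr_ge0.
  - by move=> x; rewrite mulr_ge0// mulr_ge0.
  rewrite integralN_cst ge0_integralN_Zl//; last first.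
    by rewrite mulr_ge0.
  by rewrite M1.
rewrite ge0_integralN_D//; last 3 first.
- by apply: measurable_funM => //; exact: measurable_funX.
- by move=> x; rewrite mulr_ge0// mulr_ge0.
- by move=> x; rewrite mulr_ge0// mulr_ge0.
rewrite integralN_cst ge0_integralN_Zl//; last first.
  by rewrite mulr_ge0.
by rewrite M2 -EFinM -EFinD ltry.
Qed.

End gaussian_moments.

(** * The data: empirical moments and the shape of the likelihood *)

Section empirical_moments.
Context {R : realType} (d : measure_display) (Omega : measurableType d)
  (P : probability Omega R).
Variable X : nat -> {RV P >-> mR2 R}.
Variables (w t1 t2 : R).
Hypotheses (t10 : 0 < t1) (t20 : 0 < t2).
Hypothesis indep : independent_sequence X.
Hypothesis hlaw : forall (i : nat) (A : set (mR2 R)), measurable A ->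
  distribution P (X i) A = law S1 (w, t1, t2) A.

Lemma integral_data (f : mR2 R -> \bar R) i :
  measurable_fun setT f -> (forall x, 0 <= f x)%E ->
  (\int[P]_omega f (X i omega) =
   \int[noise_measure t1 t2]_e f (structural S1 w e))%E.
Proof.
move=> mf f0.
transitivity (\int[distribution P (X i)]_x f x)%E.
  by rewrite ge0_integral_distribution.
transitivity (\int[pushforward (noise_measure t1 t2) (structural S1 w : mR2 R -> mR2 R)]_x f x)%E.
  apply: eq_measure_integral; first exact: measurable_structural.
  by move=> mS A mA _; exact: hlaw.
by rewrite (ge0_integral_pushforward (measurable_structural S1 w)).
Qed.

(** The second moments of the data are read off the squares of the linear forms
    x1, x2 and x1 + x2; being nonnegative, these fall under strong_law_nonneg. *)
Lemma empirical_square_cvg (a b : R) :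
  {ae P, forall omega,
    (\sum_(i < n) (a * (X i omega).1 + b * (X i omega).2) ^+ 2) / n%:R @[n --> \oo] -->
    a ^+ 2 * t1 + (a * w + b) ^+ 2 * t2}.
Proof.
pose f (x : mR2 R) : R := (a * x.1 + b * x.2) ^+ 2.
have mf : measurable_fun setT f by exact: measurable_lin2.
have f0 x : 0 <= f x by exact: sqr_ge0.
have mfX i : measurable_fun setT (fun omega => f (X i omega)).
  by apply: measurableT_comp mf _.
have structE (e : R * R) : a * (structural S1 w e).1 + b * (structural S1 w e).2 =
   a * e.1 + (a * w + b) * e.2 by rewrite /=; ring.
have Ef i : (\int[P]_omega (f (X i omega))%:E =
    (a ^+ 2 * t1 + (a * w + b) ^+ 2 * t2)%:E)%E.
  rewrite (@integral_data (fun x => (f x)%:E))//.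
  - under eq_integral do rewrite /f structE.
    exact: noise_sqr.
  - exact/measurable_EFinP.
have [v Ev] : exists v, forall i, (\int[P]_omega (f (X i omega) * f (X i omega))%:E = v%:E)%E.
  have fin := @noise_pow4_lty R t1 t2 a (a * w + b) t10 t20.
  have ge0 : (0 <= \int[noise_measure t1 t2]_e ((a * e.1 + (a * w + b) * e.2) ^+ 4)%:E)%E.
    by apply: integral_ge0 => x _; rewrite lee_fin (exprM _ 2 2) sqr_ge0.
  exists (fine (\int[noise_measure t1 t2]_e ((a * e.1 + (a * w + b) * e.2) ^+ 4)%:E)%E) => i.
  rewrite fineK ?ge0_fin_numE//.
  rewrite (@integral_data (fun x => (f x * f x)%:E))//.
  - by apply: eq_integral => e _; rewrite /f structE -exprD.
  - by apply/measurable_EFinP; exact: measurable_funM.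
  - by move=> x; rewrite lee_fin mulr_ge0.
apply: (strong_law_nonneg mfX _ Ef _ Ev) => // i j ij.
under eq_integral do rewrite EFinM.
rewrite (@independent_integralM _ _ R P _ _ X (fun x => (f x)%:E) (fun x => (f x)%:E))//.
- by rewrite !Ef.
- exact/measurable_EFinP.
- exact/measurable_EFinP.
Qed.

End empirical_moments.

Section likelihood.
Context {R : realType}.
Implicit Types (x : nat -> R * R) (theta : R * R * R).

Definition mean_sqr1 x n : R := (\sum_(i < n) (x i).1 ^+ 2) / n%:R.
Definition mean_cross x n : R := (\sum_(i < n) (x i).1 * (x i).2) / n%:R.
Definition mean_sqr2 x n : R := (\sum_(i < n) (x i).2 ^+ 2) / n%:R.

Lemma model_pdfE S theta (x : R * R) : Theta theta ->
  model_pdf S theta x =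
  ((Num.sqrt (2 * pi * theta.1.2))^-1 *
    expR (- ((unmix S theta.1.1 x).1 ^+ 2 / (2 * theta.1.2)))) *
  ((Num.sqrt (2 * pi * theta.2))^-1 *
    expR (- ((unmix S theta.1.1 x).2 ^+ 2 / (2 * theta.2)))).
Proof. by move=> [t10 t20]; rewrite /model_pdf /pdf2 !normal_pdf_sqrt. Qed.

Lemma inv_sqrt_expR (t : R) : 0 < t -> (Num.sqrt (2 * pi * t))^-1 =
  expR (- (ln (2 * pi) + ln t) / 2).
Proof.
move=> t0; have p0 : 0 < 2 * pi :> R by rewrite mulr_gt0 ?pi_gt0.
have pt0 : 0 < 2 * pi * t by rewrite mulr_gt0.
rewrite -lnM// -[LHS]lnK ?posrE ?invr_gt0 ?sqrtr_gt0//; congr expR.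
rewrite lnV ?posrE ?sqrtr_gt0// mulNr; congr (- _).
have -> : ln (2 * pi * t) = ln (Num.sqrt (2 * pi * t)) + ln (Num.sqrt (2 * pi * t)).
  by rewrite -lnM ?posrE ?sqrtr_gt0// -expr2 sqr_sqrtr// ltW.
by field.
Qed.

(** Markov equivalence of S1 and S2. *)
Lemma model_pdf_gamma theta (x : R * R) : Theta theta ->
  model_pdf S2 (gamma theta) x = model_pdf S1 theta x.
Proof.
move=> T0; rewrite !model_pdfE//; last exact: gamma_Theta.
move: theta T0 => [[w t1] t2] T0; have [/= t10 t20] := T0.
have [/= g10 g20] := gamma_Theta T0.
have p0 : 0 < 2 * pi :> R by rewrite mulr_gt0 ?pi_gt0.
rewrite !inv_sqrt_expR// -!expRD; congr expR.
have -> : ln (t1 * t2 / (w ^+ 2 * t2 + t1)) = ln t1 + ln t2 - ln (w ^+ 2 * t2 + t1).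
  by rewrite ln_div ?posrE ?mulr_gt0// lnM ?posrE.
by field; rewrite !gt_eqF.
Qed.

Lemma likelihoodE S theta x n : Theta theta ->
  likelihood S theta n x = \prod_(i < n) model_pdf S theta (x i).
Proof. by move=> T0; rewrite /likelihood densityE. Qed.

Lemma likelihood_ge0 S theta x n : Theta theta -> 0 <= likelihood S theta n x.
Proof. by move=> T0; rewrite likelihoodE// prodr_ge0// => i _; exact: pdf2_ge0. Qed.

Lemma likelihood_gamma theta x n : Theta theta ->
  likelihood S2 (gamma theta) n x = likelihood S1 theta n x.
Proof.
move=> T0; rewrite !likelihoodE//; last exact: gamma_Theta.
by apply: eq_bigr => i _; exact: model_pdf_gamma.
Qed.

Lemma likelihood_S3 (t1 t2 : R) x n : Theta3 (t1, t2) ->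
  likelihood S3 (0, t1, t2) n x = likelihood S1 (0, t1, t2) n x.
Proof.
move=> [/= t10 t20]; rewrite !likelihoodE//.
by apply: eq_bigr => i _; rewrite /model_pdf /= mul0r subr0 -surjective_pairing.
Qed.

Lemma measurable_likelihood S x n :
  measurable_fun (Theta : set (mR3 R)) (fun theta => likelihood S theta n x).
Proof.
have mc1 := @measurable_coord1 R; have mc2 := @measurable_coord2 R.
have mc3 := @measurable_coord3 R.
have msqrt : measurable_fun setT (@Num.sqrt R).
  by apply: continuous_measurable_fun; exact: sqrt_continuous.
have mg (s r : mR3 R -> R) : measurable_fun setT s -> measurable_fun setT r ->
    measurable_fun setT (fun theta => (Num.sqrt (2 * pi * s theta))^-1 *
       expR (- (r theta ^+ 2 / (2 * s theta)))).
  move=> ms mr; apply: measurable_funM.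
    apply: (measurableT_comp (@measurable_invr R)); apply: (measurableT_comp msqrt).
    exact: measurable_funM.
  apply: (measurableT_comp (@measurable_expR R)).
  apply: (measurableT_comp (@oppr_measurable R setT)).
  apply: measurable_fun_div; first exact: measurable_funX.
  exact: measurable_funM.
pose E theta (y : R * R) := ((Num.sqrt (2 * pi * theta.1.2))^-1 *
    expR (- ((unmix S theta.1.1 y).1 ^+ 2 / (2 * theta.1.2)))) *
  ((Num.sqrt (2 * pi * theta.2))^-1 *
    expR (- ((unmix S theta.1.1 y).2 ^+ 2 / (2 * theta.2)))).
have mE y : measurable_fun setT (fun theta : mR3 R => E theta y).
  apply: measurable_funM; apply: mg => //; case: S @E => //= _.
  - by apply: measurable_funB => //; exact: measurable_funM.
  - by apply: measurable_funB => //; exact: measurable_funM.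
apply: (@eq_measurable_fun _ _ _ _ _ (fun theta : mR3 R => \prod_(i < n) E theta (x i))).
  move=> theta /set_mem T0; rewrite likelihoodE//.
  by apply: eq_bigr => i _; rewrite model_pdfE.
by apply: measurable_funTS; apply: measurable_prod => i _.
Qed.

(** Twice the relative entropy of N(0, x t) with respect to N(0, t). *)
Definition excess (x : R) : R := x - 1 - ln x.

(** Twice the relative entropy, under S1, of the law with parameter v with respect
    to the law with parameter theta. *)
Definition divergence (v : R * R * R) theta : R :=
  excess (v.1.2 / theta.1.2) + v.2 * (theta.1.1 - v.1.1) ^+ 2 / theta.1.2 +
  excess (v.2 / theta.2).

(** The maximum likelihood estimate in S1: regression coefficient, residual
    variance, variance of X(2). *)
Definition mle x n : R * R * R :=
  (mean_cross x n / mean_sqr2 x n, mean_sqr1 x n - mean_cross x n ^+ 2 / mean_sqr2 x n, mean_sqr2 x n).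

Definition max_likelihood x n : R :=
  expR (- n%:R / 2 * (2 * ln (2 * pi) + 2 + ln (mle x n).1.2 + ln (mle x n).2)).

(** The Gaussian log-likelihood depends on the data through the second moments
    only, and these are encoded in the maximum likelihood estimate. *)
Lemma likelihood_divergence theta x n : Theta theta -> Theta (mle x n) ->
  likelihood S1 theta n x =
  max_likelihood x n * expR (- n%:R / 2 * divergence (mle x n) theta).
Proof.
move=> T0 [/= V0 C0].
have [n0|n0] := posnP n.
  by rewrite n0 /likelihood big_ord0 /max_likelihood oppr0 !mul0r !expR0 mulr1.
have nR : 0 < n%:R :> R by rewrite ltr0n.
rewrite likelihoodE// /max_likelihood -expRD.
under eq_bigr do rewrite model_pdfE//.
move: theta T0 => [[w t1] t2] [/= t10 t20].
under eq_bigr do rewrite !inv_sqrt_expR// -!expRD.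
rewrite -expR_sum; congr expR.
set A := mean_sqr1 x n in V0 *; set B := mean_cross x n in V0 *; set C := mean_sqr2 x n in V0 C0 *.
have sA : \sum_(i < n) (x i).1 ^+ 2 = n%:R * A.
  by rewrite /A /mean_sqr1 mulrC divfK// gt_eqF.
have sB : \sum_(i < n) (x i).1 * (x i).2 = n%:R * B.
  by rewrite /B /mean_cross mulrC divfK// gt_eqF.
have sC : \sum_(i < n) (x i).2 ^+ 2 = n%:R * C.
  by rewrite /C /mean_sqr2 mulrC divfK// gt_eqF.
transitivity (\sum_(i < n) ((- (2 * ln (2 * pi) + ln t1 + ln t2) / 2) +
   (- (2 * t1)^-1 * (x i).1 ^+ 2 + ((w / t1) * ((x i).1 * (x i).2)
    + - (w ^+ 2 / (2 * t1) + (2 * t2)^-1) * (x i).2 ^+ 2)))).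
  by apply: eq_bigr => i _; field; rewrite !gt_eqF.
have sK (k : R) : \sum_(i < n) k = n%:R * k by rewrite sumr_const card_ord mulr_natl.
rewrite !big_split/= sK -!mulr_sumr.
rewrite sA sB sC.
rewrite /divergence /excess /mle /= -/A -/B -/C.
rewrite (@ln_div _ _ t1) ?posrE// (@ln_div _ _ t2) ?posrE//.
by field; rewrite !gt_eqF.
Qed.

End likelihood.

(** * Concentration of the likelihood at the true parameter *)

Section divergence_bounds.
Context {R : realType}.
Implicit Types (theta v : R * R * R).

(** With y the square root of x this is ln y <= y - 1. *)
Lemma excess_sqrt (x : R) : 0 < x -> (Num.sqrt x - 1) ^+ 2 <= excess x.
Proof.
move=> x0; set y := Num.sqrt x; have y0 : 0 < y by rewrite sqrtr_gt0.
have -> : x = y * y by rewrite -expr2 sqr_sqrtr// ltW.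
rewrite /excess lnM ?posrE//.
have : ln y <= y - 1.
  have := @le_ln1Dx R (y - 1); rewrite addrCA subrr addr0; apply.
  by rewrite ltrBrDr addNr.
move=> h; rewrite -subr_ge0.
have -> : y * y - 1 - (ln y + ln y) - (y - 1) ^+ 2 = 2 * (y - 1 - ln y) by ring.
by rewrite mulr_ge0// subr_ge0.
Qed.

Lemma excess_ge0 (x : R) : 0 < x -> 0 <= excess x.
Proof. by move=> x0; rewrite (le_trans _ (excess_sqrt x0))// sqr_ge0. Qed.

Lemma excess_lower (x r : R) : 0 < x -> 0 < r -> r <= 1 -> r <= `|x - 1| ->
  (r / 4) ^+ 2 <= excess x.
Proof.
move=> x0 r0 r1 rx; rewrite (le_trans _ (excess_sqrt x0))//.
have y0 := sqrtr_ge0 x; have yx := sqr_sqrtr (ltW x0).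
set y := Num.sqrt x in y0 yx *.
move: rx; rewrite -yx ler_normr => /orP[] h.
- have : r / 4 <= y - 1 by nra.
  by nra.
- have : r / 4 <= 1 - y by nra.
  by nra.
Qed.

(** A gap between the variances V and t, bounded below, bounds V / t away from 1
    even though t ranges over the whole half-line. *)
Lemma ratio_away (t0 delta : R) : 0 < t0 -> 0 < delta ->
  exists2 r, 0 < r <= 1 & forall V t, `|V - t0| < delta / 2 -> `|V - t0| < t0 -> 0 < V ->
    0 < t -> delta <= `|t0 - t| -> r <= `|V / t - 1|.
Proof.
move=> t00 d0; pose a := delta / (8 * t0).
have a0 : 0 < a by rewrite divr_gt0// mulr_gt0.
exists (Num.min (1 / 2) a).
  by rewrite lt_min a0 ge_min; apply/andP; split; [lra|apply/orP; left; lra].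
move=> V t Vd Vt V0 tt0 dt.
have Vt_ge : delta / 2 <= `|V - t|.
  have := ler_normD (t0 - V) (V - t); rewrite subrKA [X in _ <= X + _]distrC => h.
  by lra.
have -> : V / t - 1 = (V - t) / t by field; rewrite gt_eqF.
rewrite normrM normfV (gtr0_norm tt0) ler_pdivlMr//.
have [tV|tV] := leP (2 * V) t.
  have h : Num.min (1 / 2) a * t <= 1 / 2 * t by rewrite ler_pM2r// ge_min lexx.
  rewrite (le_trans h)// distrC (le_trans _ (ler_norm _))//; lra.
have h : Num.min (1 / 2) a * t <= a * t by rewrite ler_pM2r// ge_min lexx orbT.
rewrite (le_trans h)// (le_trans _ Vt_ge)//.
have V2 : V < 2 * t0 by move: Vt; rewrite ltr_norml => /andP[]; lra.
rewrite /a mulrAC ler_pdivrMr ?mulr_gt0//.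
have -> : delta / 2 * (8 * t0) = delta * (4 * t0) by field.
by rewrite ler_pM2l//; lra.
Qed.

Lemma divergence_ge0 v theta : Theta v -> Theta theta -> 0 <= divergence v theta.
Proof.
move=> [v10 v20] [t10 t20].
rewrite addr_ge0 ?excess_ge0 ?divr_gt0// addr_ge0 ?excess_ge0 ?divr_gt0//.
by rewrite divr_ge0 ?(ltW t10)// mulr_ge0 ?sqr_ge0// ltW.
Qed.

Lemma cvg_coord (w t1 t2 : R) (T : Type) (F : set_system T) (v : T -> R * R * R) : Filter F ->
  v x @[x --> F] --> (w, t1, t2) ->
  [/\ (v x).1.1 @[x --> F] --> w, (v x).1.2 @[x --> F] --> t1 & (v x).2 @[x --> F] --> t2].
Proof.
move=> FF cv; split.
- apply: (cvg_comp v (fun x => x.1.1) cv).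
  by apply: (cvg_comp (fst : R * R * R -> R * R) fst); exact: cvg_fst.
- apply: (cvg_comp v (fun x => x.1.2) cv).
  by apply: (cvg_comp (fst : R * R * R -> R * R) snd); [exact: cvg_fst|exact: cvg_snd].
- by apply: (cvg_comp v (fun x => x.2) cv); exact: cvg_snd.
Qed.

(** Out of the box one of the three coordinates of theta is off by delta.  A wrong
    variance makes one excess large, by ratio_away.  If the variance t1 is nearly
    right, it is bounded, so that a wrong w makes the quadratic term large. *)
Lemma divergence_away (w t1 t2 delta : R) (v : nat -> R * R * R) :
  Theta (w, t1, t2) -> 0 < delta -> v n @[n --> \oo] --> (w, t1, t2) ->
  exists2 eta, 0 < eta & \forall n \near \oo, forall theta, Theta theta ->
    ~ box3 (w, t1, t2) delta theta -> eta <= divergence (v n) theta.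
Proof.
move=> [/= t10 t20] d0 /cvg_coord[cw c1 c2].
have [r1 /andP[r10 r11] away1] := ratio_away t10 d0.
have [r2 /andP[r20 r21] away2] := ratio_away t20 d0.
pose e3 := (t2 / 2) * (delta / 2) ^+ 2 / (t1 + delta).
have e30 : 0 < e3.
  by rewrite divr_gt0 ?addr_gt0// mulr_gt0 ?divr_gt0// exprn_gt0// divr_gt0.
exists (Num.min e3 (Num.min ((r1 / 4) ^+ 2) ((r2 / 4) ^+ 2))).
  by rewrite !lt_min e30/= !exprn_gt0 ?divr_gt0.
have d20 : 0 < delta / 2 by rewrite divr_gt0.
have t220 : 0 < t2 / 2 by rewrite divr_gt0.
have n1 : \forall n \near \oo, `|(v n).1.2 - t1| < delta / 2.
  by move/cvgrPdist_lt: c1 => /(_ _ d20); apply: filterS => n; rewrite distrC.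
have n2 : \forall n \near \oo, `|(v n).1.2 - t1| < t1.
  by move/cvgrPdist_lt: c1 => /(_ _ t10); apply: filterS => n; rewrite distrC.
have n3 : \forall n \near \oo, `|(v n).2 - t2| < delta / 2.
  by move/cvgrPdist_lt: c2 => /(_ _ d20); apply: filterS => n; rewrite distrC.
have n4 : \forall n \near \oo, `|(v n).2 - t2| < t2 / 2.
  by move/cvgrPdist_lt: c2 => /(_ _ t220); apply: filterS => n; rewrite distrC.
have n5 : \forall n \near \oo, `|w - (v n).1.1| < delta / 2.
  by move/cvgrPdist_lt: cw => /(_ _ d20).
near=> n => -[[w' s1] s2] [/= s10 s20] nbox.
have V1 : `|(v n).1.2 - t1| < delta / 2 by near: n.
have V2 : `|(v n).1.2 - t1| < t1 by near: n.
have C1 : `|(v n).2 - t2| < delta / 2 by near: n.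
have C2 : `|(v n).2 - t2| < t2 / 2 by near: n.
have W1 : `|w - (v n).1.1| < delta / 2 by near: n.
have V0 : 0 < (v n).1.2.
  by move: V2; rewrite ltr_norml => /andP[+ _]; rewrite ltrBrDr addNr.
have C0 : t2 / 2 < (v n).2.
  move: C2; rewrite ltr_norml => /andP[+ _].
  by rewrite ltrBrDr (_ : - (t2 / 2) + t2 = t2 / 2)//; field.
have C00 := lt_trans t220 C0.
rewrite /divergence /=.
have E1 : 0 <= excess ((v n).1.2 / s1) by rewrite excess_ge0 ?divr_gt0.
have E2 : 0 <= excess ((v n).2 / s2) by rewrite excess_ge0 ?divr_gt0.
have E3 : 0 <= (v n).2 * (w' - (v n).1.1) ^+ 2 / s1.
  by rewrite divr_ge0 ?(ltW s10)// mulr_ge0 ?sqr_ge0// ltW.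
have [s1t|s1t] := leP delta `|t1 - s1|.
  have h : (r1 / 4) ^+ 2 <= excess ((v n).1.2 / s1).
    by apply: excess_lower; rewrite ?divr_gt0//; apply: away1.
  rewrite (@le_trans _ _ ((r1 / 4) ^+ 2)) ?ge_min ?lexx ?orbT//.
  by rewrite (le_trans h)// -addrA lerDl addr_ge0.
have [s2t|s2t] := leP delta `|t2 - s2|.
  have h : (r2 / 4) ^+ 2 <= excess ((v n).2 / s2).
    apply: excess_lower; rewrite ?divr_gt0//; apply: away2 => //.
    by rewrite (lt_trans C2)// ltr_pdivrMr// ltr_pMr// ltr1n.
  rewrite (@le_trans _ _ ((r2 / 4) ^+ 2)) ?ge_min ?lexx ?orbT//.
  by rewrite (le_trans h)// lerDr addr_ge0.
have wt : delta <= `|w - w'|.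
  by rewrite leNgt; apply/negP => wt; apply: nbox; split => //; split.
have h : e3 <= (v n).2 * (w' - (v n).1.1) ^+ 2 / s1.
  have wv : delta / 2 <= `|w' - (v n).1.1|.
    have := ler_normD (w - (v n).1.1) ((v n).1.1 - w').
    by rewrite subrKA [X in _ <= _ + X]distrC; lra.
  have wv2 : (delta / 2) ^+ 2 <= (w' - (v n).1.1) ^+ 2.
    by rewrite -[leRHS]real_normK ?num_real// lerXn2r ?nnegrE// ltW.
  have s1le : s1 <= t1 + delta.
    by move: s1t; rewrite distrC ltr_norml => /andP[_ +]; rewrite ltrBlDl => /ltW.
  rewrite /e3 ler_pM//.
  - by rewrite mulr_ge0 ?sqr_ge0// ltW.
  - by rewrite invr_ge0 addr_ge0// ltW.
  - by apply: ler_pM => //; rewrite ?sqr_ge0// ltW.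
  - by rewrite lef_pV2 ?posrE// addr_gt0.
rewrite (@le_trans _ _ e3) ?ge_min ?lexx//.
by rewrite (le_trans h)// -addrA addrCA lerDl addr_ge0.
Unshelve. all: by end_near. Qed.

Lemma continuous_excess (x : R) : 0 < x -> {for x, continuous (@excess R)}.
Proof.
move=> x0; apply: cvgB; last exact: continuous_ln.
by apply: cvgB; [exact: cvg_id|exact: cvg_cst].
Qed.

Lemma excess1 : excess (1 : R) = 0.
Proof. by rewrite /excess ln1 !subrr. Qed.

(** Joint continuity at a point of the diagonal, where the divergence vanishes. *)
Lemma divergence_close (theta0 : R * R * R) (eta : R) : Theta theta0 -> 0 < eta ->
  exists Q1 Q2 : set (R * R * R), [/\ nbhs theta0 Q1, nbhs theta0 Q2 &
    forall v theta, Q1 v -> Q2 theta -> divergence v theta < eta].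
Proof.
move: theta0 => [[w t1] t2] [/= t10 t20] eta0.
set th := (w, t1, t2).
have cf : (fun z : (R * R * R) * (R * R * R) => z.1) @ (th, th) --> th by exact: cvg_fst.
have cs : (fun z : (R * R * R) * (R * R * R) => z.2) @ (th, th) --> th by exact: cvg_snd.
have [a1 a2 a3] := cvg_coord _ cf; have [b1 b2 b3] := cvg_coord _ cs.
have cD : (fun z : (R * R * R) * (R * R * R) => divergence z.1 z.2) @ (th, th) --> (0 : R).
  have -> : 0 = excess (t1 / t1) + t2 * (w - w) * (w - w) / t1 + excess (t2 / t2) :> R.
    by rewrite !divff ?gt_eqF// excess1 subrr !mulr0 mul0r !addr0.
  rewrite /divergence.
  have -> : (fun z : (R * R * R) * (R * R * R) =>
      excess (z.1.1.2 / z.2.1.2) + z.1.2 * (z.2.1.1 - z.1.1.1) ^+ 2 / z.2.1.2 +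
      excess (z.1.2 / z.2.2)) = (fun z : (R * R * R) * (R * R * R) =>
      excess (z.1.1.2 / z.2.1.2) + z.1.2 * (z.2.1.1 - z.1.1.1) * (z.2.1.1 - z.1.1.1) / z.2.1.2 +
      excess (z.1.2 / z.2.2)).
    by apply/funext => z; rewrite expr2 mulrA.
  have q1 : (fun z : (R * R * R) * (R * R * R) => z.1.1.2 / z.2.1.2) @ (th, th) --> t1 / t1.
    by apply: cvgM => //; apply: cvgV => //; rewrite gt_eqF.
  have q2 : (fun z : (R * R * R) * (R * R * R) => z.1.2 / z.2.2) @ (th, th) --> t2 / t2.
    by apply: cvgM => //; apply: cvgV => //; rewrite gt_eqF.
  apply: cvgD.
    apply: cvgD.
      by apply: (cvg_comp _ (@excess R) q1); apply: continuous_excess; rewrite divr_gt0.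
    apply: cvgM; last by apply: cvgV => //; rewrite gt_eqF.
    apply: cvgM; last exact: cvgB.
    by apply: cvgM => //; exact: cvgB.
  by apply: (cvg_comp _ (@excess R) q2); apply: continuous_excess; rewrite divr_gt0.
have [[Q1 Q2] /= [n1 n2] Q12] := cvgr_lt _ cD _ eta0.
by exists Q1, Q2; split => // v theta q1 q2; apply: (Q12 (v, theta)).
Qed.

End divergence_bounds.

Section concentration.
Context {R : realType}.
Variables (w t1 t2 : R) (x : nat -> R * R).
Let theta0 : R * R * R := (w, t1, t2).
Hypothesis T0 : Theta theta0.
Hypothesis cmle : mle x n @[n --> \oo] --> theta0.

(** The likelihood of S1 divided by its maximum. *)
Definition weight n theta : R := expR (- n%:R / 2 * divergence (mle x n) theta).

(** The evidence of S1 under the prior p, divided by the maximal likelihood. *)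
Definition weighted n (p : R * R * R -> R) : \bar R :=
  (\int[lebesgue3]_(theta in Theta) (weight n theta * p theta)%:E)%E.

Lemma near_mle_Theta : \forall n \near \oo, Theta (mle x n).
Proof. by apply: cmle; exact: nbhs_Theta. Qed.

Lemma weight_ge0 n theta : 0 <= weight n theta.
Proof. exact: expR_ge0. Qed.

Lemma weight_le1 n theta : Theta (mle x n) -> Theta theta -> weight n theta <= 1.
Proof.
move=> Tm Tt; rewrite /weight -[leRHS]expR0 ler_expR mulNr mulNr oppr_le0.
by rewrite mulr_ge0 ?divergence_ge0.
Qed.

Lemma likelihood_weight n theta : Theta (mle x n) -> Theta theta ->
  likelihood S1 theta n x = max_likelihood x n * weight n theta.
Proof. by move=> Tm Tt; rewrite likelihood_divergence. Qed.

Lemma measurable_weight n : Theta (mle x n) ->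
  measurable_fun (Theta : set (mR3 R)) (weight n).
Proof.
move=> Tm.
apply: (@eq_measurable_fun _ _ _ _ _
  (fun theta : mR3 R => (max_likelihood x n)^-1 * likelihood S1 theta n x)).
  move=> theta /set_mem Tt; rewrite likelihood_weight// mulKf// gt_eqF//.
  exact: expR_gt0.
by apply: measurable_funM => //; exact: measurable_likelihood.
Qed.

Section prior_mass.
Variable p : R * R * R -> R.
Hypothesis mp : measurable_fun (Theta : set (mR3 R)) p.
Hypothesis p0 : forall theta, Theta theta -> 0 <= p theta.
Hypothesis p1 : (\int[lebesgue3]_(theta in Theta) (p theta)%:E = 1)%E.

Lemma weighted_ge0 n : (0 <= weighted n p)%E.
Proof.
by apply: integral_ge0 => theta Tt; rewrite lee_fin mulr_ge0 ?weight_ge0 ?p0.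
Qed.

Lemma weighted_fin n : Theta (mle x n) -> weighted n p \is a fin_num.
Proof.
move=> Tm; rewrite ge0_fin_numE ?weighted_ge0//.
rewrite (@le_lt_trans _ _ 1%E)// ?ltry// -p1; apply: ge0_le_integral => //.
- exact: measurable_Theta.
- by move=> theta Tt; rewrite lee_fin mulr_ge0 ?weight_ge0 ?p0.
- by apply/measurable_EFinP; apply: measurable_funM => //; exact: measurable_weight.
- exact/measurable_EFinP.
- move=> theta Tt; rewrite lee_fin ler_piMl ?p0//; exact: weight_le1.
Qed.

(** Off the box the divergence is at least some eta, so the weight is at most
    e^(-n eta / 2).  On a smaller box the divergence is at most eta / 2 and p is
    bounded below, so the weighted mass of p is at least kappa e^(-n eta / 4).
    The quotient of the two bounds tends to 0. *)
Lemma weight_concentration (delta eps : R) :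
  {for theta0, continuous p} -> 0 < p theta0 -> 0 < delta -> 0 < eps ->
  \forall n \near \oo, (0 < weighted n p)%E /\
    forall theta, Theta theta -> ~ box3 theta0 delta theta ->
      ((weight n theta)%:E <= eps%:E * weighted n p)%E.
Proof.
move=> cp pt0 d0 e0.
have [eta eta0 away] := divergence_away T0 d0 cmle.
have eta20 : 0 < eta / 2 by rewrite divr_gt0.
have [Q1 [Q2 [nQ1 nQ2 close]]] := divergence_close T0 eta20.
have pt20 : p theta0 / 2 < p theta0 by lra.
have np : nbhs theta0 [set theta | p theta0 / 2 < p theta] by exact: (cvgr_gt _ cp).
have [e' e'0 boxQ] := nbhs_box3 (filterI (filterI nQ2 np) (nbhs_Theta T0)).
pose kappa := p theta0 / 2 * (e' *+ 2) ^+ 3.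
have kappa0 : 0 < kappa by rewrite mulr_gt0 ?divr_gt0// exprn_gt0// mulrn_wgt0.
have nsmall : \forall n \near \oo, expR (- n%:R / 4 * eta) <= eps * kappa.
  have c : expR (- (eta / 4 * n%:R)) @[n --> \oo] --> (0 : R).
    have cn : (eta / 4 * n%:R : R) @[n --> \oo] --> +oo%R.
      apply/cvgryPge => A; move/cvgryPge: (@cvgr_idn R) => /(_ (A / (eta / 4))).
      by apply: filterS => n; rewrite ler_pdivrMr ?divr_gt0// mulrC.
    exact: (cvg_comp _ (fun y => expR (- y)) cn (@cvgr_expR R)).
  move/cvgrPdist_le: c => /(_ _ (mulr_gt0 e0 kappa0)); apply: filterS => n.
  rewrite sub0r normrN ger0_norm ?expR_ge0//; apply: le_trans.
  by rewrite ler_expR; rewrite le_eqVlt; apply/orP; left; apply/eqP; field.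
have nclose : \forall n \near \oo, Q1 (mle x n) by exact: cmle.
have nT := near_mle_Theta.
near=> n.
have Tm : Theta (mle x n) by near: n.
have q1 : Q1 (mle x n) by near: n.
have Esmall : expR (- n%:R / 4 * eta) <= eps * kappa by near: n.
have aw : forall theta, Theta theta -> ~ box3 (w, t1, t2) delta theta ->
    eta <= divergence (mle x n) theta by near: n.
set E := expR (- n%:R / 4 * eta) in Esmall *.
have E0 : 0 < E by exact: expR_gt0.
have lower : ((E * kappa)%:E <= weighted n p)%E.
  have mB := measurable_box3 theta0 e'.
  have BT : box3 theta0 e' `<=` Theta by move=> theta /boxQ[].
  apply: (@le_trans _ _ (\int[lebesgue3]_(theta in box3 theta0 e')
      (weight n theta * p theta)%:E)%E); last first.
    apply: ge0_subset_integral => //.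
    - exact: measurable_Theta.
    - by apply/measurable_EFinP; apply: measurable_funM => //; exact: measurable_weight.
    - by move=> theta Tt; rewrite lee_fin mulr_ge0 ?weight_ge0 ?p0.
  rewrite /kappa mulrA EFinM -(lebesgue3_box theta0 (ltW e'0)).
  rewrite -integral_cst//; apply: ge0_le_integral => //.
  - by move=> theta _; rewrite lee_fin mulr_ge0 ?(ltW E0)// divr_ge0// ltW.
  - apply/measurable_EFinP; apply: (measurable_funS (measurable_Theta (R := R)) BT).
    by apply: measurable_funM => //; exact: measurable_weight.
  move=> theta Bt; rewrite lee_fin; have [[q2 /= pt] Tt] := boxQ _ Bt.
  apply: ler_pM; rewrite ?(ltW E0) ?divr_ge0 ?(ltW pt0) ?(ltW pt)//.
  rewrite /E /weight ler_expR.
  have := close _ _ q1 q2; rewrite -subr_gt0 => h.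
  rewrite -subr_ge0 (_ : _ - _ = n%:R / 2 * (eta / 2 - divergence (mle x n) theta)); last by field.
  by rewrite mulr_ge0// ltW.
split; first by rewrite (lt_le_trans _ lower)// lte_fin mulr_gt0.
move=> theta Tt nB.
apply: (@le_trans _ _ (eps%:E * (E * kappa)%:E)%E); last first.
  by apply: lee_wpmul2l => //; rewrite lee_fin ltW.
rewrite -EFinM lee_fin.
have -> : eps * (E * kappa) = E * (eps * kappa) by ring.
apply: (@le_trans _ _ (E * E)); last by rewrite ler_pM2l.
rewrite /E /weight -expRD ler_expR.
have {}aw := aw _ Tt nB.
rewrite -subr_ge0 (_ : _ - _ = n%:R / 2 * (divergence (mle x n) theta - eta)); last by field.
by rewrite mulr_ge0// subr_ge0.
Unshelve. all: by end_near. Qed.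

End prior_mass.

(** Near the true parameter q <= c p; elsewhere the weight is at most eps times
    the weighted mass of p, and q has mass 1. *)
Lemma weighted_le (p q : R * R * R -> R) (c eps : R) :
  measurable_fun (Theta : set (mR3 R)) p -> measurable_fun (Theta : set (mR3 R)) q ->
  (forall theta, Theta theta -> 0 <= p theta) ->
  (forall theta, Theta theta -> 0 <= q theta) ->
  (\int[lebesgue3]_(theta in Theta) (p theta)%:E = 1)%E ->
  (\int[lebesgue3]_(theta in Theta) (q theta)%:E = 1)%E ->
  {for theta0, continuous p} -> {for theta0, continuous q} ->
  0 < p theta0 -> 0 <= c -> q theta0 < c * p theta0 -> 0 < eps ->
  \forall n \near \oo, (weighted n q <= (c + eps)%:E * weighted n p)%E.
Proof.
move=> mp mq p0 q0 p1 q1 cp cq pt0 c0 qc e0.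
have cdiff : (fun theta => q theta - c * p theta) @ theta0 --> q theta0 - c * p theta0.
  by apply: cvgB => //; apply: cvgM => //; exact: cvg_cst.
have nb : nbhs theta0 [set theta | q theta - c * p theta < 0].
  by apply: (cvgr_lt _ cdiff); rewrite subr_lt0.
have [delta d0 boxQ] := nbhs_box3 nb.
have nconc := weight_concentration mp p0 cp pt0 d0 e0.
have nT := near_mle_Theta.
near=> n.
have Tm : Theta (mle x n) by near: n.
have [Jp0 hout] : (0 < weighted n p)%E /\ forall theta, Theta theta ->
    ~ box3 theta0 delta theta -> ((weight n theta)%:E <= eps%:E * weighted n p)%E.
  by near: n.
have Jfin := weighted_fin mp p0 p1 Tm.
pose J := fine (weighted n p).
have JE : weighted n p = J%:E by rewrite fineK.
have J0 : 0 < J by rewrite -lte_fin -JE.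
have mT := measurable_Theta (R := R).
have mw := measurable_weight Tm.
apply: (@le_trans _ _ (\int[lebesgue3]_(theta in Theta)
   (c%:E * (weight n theta * p theta)%:E + (eps * J)%:E * (q theta)%:E))%E).
  apply: ge0_le_integral => //.
  - by move=> theta Tt; rewrite lee_fin mulr_ge0 ?weight_ge0 ?q0.
  - by apply/measurable_EFinP; exact: measurable_funM.
  - apply/measurable_EFinP; apply: measurable_funD; apply: measurable_funM => //.
    exact: measurable_funM.
  move=> theta Tt; rewrite -!EFinM -EFinD lee_fin.
  have wp0 : 0 <= weight n theta * p theta by rewrite mulr_ge0 ?weight_ge0 ?p0.
  have [Bt|nBt] := pselect (box3 theta0 delta theta).
    have := boxQ _ Bt; rewrite /= subr_lt0 => /ltW h.
    apply: (@le_trans _ _ (weight n theta * (c * p theta))).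
      by rewrite ler_wpM2l ?weight_ge0.
    have -> : weight n theta * (c * p theta) = c * (weight n theta * p theta) by ring.
    by rewrite lerDl !mulr_ge0 ?q0// ltW.
  have := hout _ Tt nBt; rewrite JE -EFinM lee_fin => h.
  apply: (@le_trans _ _ (eps * J * q theta)); first by rewrite ler_wpM2r ?q0.
  by rewrite lerDr mulr_ge0.
rewrite ge0_integralD//; last 4 first.
- by move=> theta Tt; rewrite -EFinM lee_fin mulr_ge0// mulr_ge0 ?weight_ge0 ?p0.
- by apply/measurable_EFinP; apply: measurable_funM => //; exact: measurable_funM.
- by move=> theta Tt; rewrite -EFinM lee_fin mulr_ge0 ?q0// mulr_ge0// ltW.
- by apply/measurable_EFinP; apply: measurable_funM.
rewrite ge0_integralZl//; last 2 first.
- by apply/measurable_EFinP; exact: measurable_funM.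
- by move=> theta Tt; rewrite lee_fin mulr_ge0 ?weight_ge0 ?p0.
rewrite ge0_integralZl//; last 2 first.
- by first [exact/measurable_EFinP|move=> theta Tt; rewrite lee_fin q0].
- by rewrite lee_fin mulr_ge0// ltW.
rewrite -/(weighted n p) q1 mule1 JE -!EFinM -EFinD lee_fin.
by rewrite mulrDl.
Unshelve. all: by end_near. Qed.

(** Both bounds on the ratio come from weighted_le, the lower one with p and q
    exchanged; that one is only needed, and only available, if q does not vanish
    at the true parameter. *)
Lemma weighted_ratio_cvg (p q : R * R * R -> R) :
  measurable_fun (Theta : set (mR3 R)) p -> measurable_fun (Theta : set (mR3 R)) q ->
  (forall theta, Theta theta -> 0 <= p theta) ->
  (forall theta, Theta theta -> 0 <= q theta) ->
  (\int[lebesgue3]_(theta in Theta) (p theta)%:E = 1)%E ->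
  (\int[lebesgue3]_(theta in Theta) (q theta)%:E = 1)%E ->
  {for theta0, continuous p} -> {for theta0, continuous q} ->
  0 < p theta0 ->
  fine (weighted n q) / fine (weighted n p) @[n --> \oo] --> q theta0 / p theta0.
Proof.
move=> mp mq p0 q0 p1 q1 cp cq pt0.
set r := q theta0 / p theta0.
have r0 : 0 <= r by rewrite divr_ge0 ?q0// ltW.
have qr : q theta0 = r * p theta0 by rewrite /r divfK// gt_eqF.
apply/cvgrPdist_le => eps e0.
have nT := near_mle_Theta.
have e20 : 0 < eps / 2 by rewrite divr_gt0.
have nJ := weight_concentration mp p0 cp pt0 e0 e0.
have nup : \forall n \near \oo, (weighted n q <= (r + eps)%:E * weighted n p)%E.
  have -> : r + eps = r + eps / 2 + eps / 2 by field.
  apply: weighted_le => //; first by rewrite addr_ge0// ltW.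
  by rewrite qr ltr_pM2r// ltrDl.
have nlow : \forall n \near \oo, ((r - eps)%:E * weighted n p <= weighted n q)%E.
  have [re|re] := leP r eps.
    near=> n; apply: (@le_trans _ _ 0%E); last exact: weighted_ge0.
    by apply: mule_le0_ge0; [rewrite lee_fin subr_le0|exact: weighted_ge0].
  have s0 : 0 < r - eps by rewrite subr_gt0.
  have r00 : 0 < r by rewrite (lt_trans e0).
  have qt0 : 0 < q theta0 by rewrite qr mulr_gt0.
  pose e' := ((r - eps)^-1 - r^-1) / 2.
  have e'0 : 0 < e' by rewrite divr_gt0// subr_gt0 ltf_pV2 ?posrE//; lra.
  have := @weighted_le q p (r^-1 + e') e' mq mp q0 p0 q1 p1 cq cp qt0.
  have -> : r^-1 + e' + e' = (r - eps)^-1 by rewrite /e'; field; rewrite !gt_eqF.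
  have h1 : 0 <= r^-1 + e' by rewrite addr_ge0// ?invr_ge0// ltW.
  have h2 : p theta0 < (r^-1 + e') * q theta0.
    rewrite qr mulrA mulrDl mulVf ?gt_eqF// mulrDl mul1r ltrDl.
    by rewrite mulr_gt0// mulr_gt0.
  move=> /(_ h1 h2 e'0); apply: filterS => n h.
  have := @lee_wpmul2l _ (r - eps)%:E _ _ _ h.
  rewrite muleA -EFinM divff ?gt_eqF// mul1e; apply.
  by rewrite lee_fin ltW.
near=> n.
have Tm : Theta (mle x n) by near: n.
have [Jp0 _] : (0 < weighted n p)%E /\ forall theta, Theta theta ->
    ~ box3 theta0 eps theta -> ((weight n theta)%:E <= eps%:E * weighted n p)%E.
  by near: n.
have up : (weighted n q <= (r + eps)%:E * weighted n p)%E by near: n.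
have low : ((r - eps)%:E * weighted n p <= weighted n q)%E by near: n.
have fp := weighted_fin mp p0 p1 Tm; have fq := weighted_fin mq q0 q1 Tm.
move: up low Jp0; rewrite -(fineK fp) -(fineK fq) -!EFinM !lee_fin lte_fin.
set a := fine (weighted n q); set b := fine (weighted n p) => up low b0.
rewrite distrC ler_distl ler_pdivlMr// ler_pdivrMr//.
by rewrite low up.
Unshelve. all: by end_near. Qed.

(** The slice w = 0 misses the box of radius |w| around the true parameter. *)
Lemma weight_independence_small (p : R * R * R -> R) (eps : R) : w != 0 ->
  measurable_fun (Theta : set (mR3 R)) p ->
  (forall theta, Theta theta -> 0 <= p theta) ->
  {for theta0, continuous p} -> 0 < p theta0 -> 0 < eps ->
  \forall n \near \oo, forall s1 s2, Theta3 (s1, s2) ->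
    ((weight n (0, s1, s2))%:E <= eps%:E * weighted n p)%E.
Proof.
move=> w0 mp p0 cp pt0 e0.
have w00 : 0 < `|w| by rewrite normr_gt0.
apply: filterS (weight_concentration mp p0 cp pt0 w00 e0) => n [_ h] s1 s2 [s10 s20].
apply: h; first by split.
by move=> [[/= + _] _]; rewrite /ball/= subr0 ltxx.
Qed.

End concentration.

(** * Limit of the posterior probability *)

Lemma posterior_algebra (R : realFieldType) (M b a2 a3 : R) :
  0 < M -> 0 < b -> 0 <= a2 -> 0 <= a3 ->
  M * b / (M * b + M * a2 + M * a3) = 1 / (1 + (a2 / b + a3 / b)).
Proof.
move=> M0 b0 a20 a30.
rewrite -!mulrDr -mulf_div divff ?gt_eqF// mul1r.
have -> : 1 + (a2 / b + a3 / b) = (b + a2 + a3) / b by field; rewrite gt_eqF.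
by rewrite div1r invf_div.
Qed.

Section posterior_limit.
Context {R : realType}.
Variables (w t1 t2 : R) (x : nat -> R * R).
Let theta0 : R * R * R := (w, t1, t2).
Hypothesis T0 : Theta theta0.
Hypothesis w0 : w != 0.
Hypothesis cmle : mle x n @[n --> \oo] --> theta0.
Variables (p1 p2 : R * R * R -> R) (p3 : R * R -> R).
Hypothesis hp1 : is_prior lebesgue3 (Theta : set (mR3 R)) p1.
Hypothesis hp2 : is_prior lebesgue3 (Theta : set (mR3 R)) p2.
Hypothesis hp3 : is_prior lebesgue2 (Theta3 : set (mR2 R)) p3.
Hypothesis cp1 : {for theta0, continuous p1}.
Hypothesis cp2 : {for gamma theta0, continuous p2}.
Hypothesis pos : 0 < p1 theta0.

Lemma measurable_Theta3 : measurable (Theta3 : set (mR2 R)).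
Proof.
have -> : Theta3 = ((fst : mR2 R -> R) @^-1` `]0, +oo[) `&`
                   ((snd : mR2 R -> R) @^-1` `]0, +oo[).
  by apply/seteqP; split=> y /=; rewrite !in_itv/= !andbT.
apply: measurableI; rewrite -[X in measurable X]setTI.
  exact: (@measurable_fst _ _ (measurableTypeR R) (measurableTypeR R)).
exact: (@measurable_snd _ _ (measurableTypeR R) (measurableTypeR R)).
Qed.

Lemma max_likelihood_gt0 n : 0 < max_likelihood x n.
Proof. exact: expR_gt0. Qed.

Lemma integral_likelihood_S1 (p : R * R * R -> R) n :
  measurable_fun (Theta : set (mR3 R)) p ->
  (forall theta, Theta theta -> 0 <= p theta) -> Theta (mle x n) ->
  (\int[lebesgue3]_(theta in Theta) (likelihood S1 theta n x * p theta)%:E =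
   (max_likelihood x n)%:E * weighted x n p)%E.
Proof.
move=> mp p0 Tm; rewrite -ge0_integralZl//.
- by apply: eq_integral => theta /set_mem Tt; rewrite likelihood_weight// -EFinM mulrA.
- exact: measurable_Theta.
- by apply/measurable_EFinP; apply: measurable_funM => //; exact: measurable_weight.
- by move=> theta Tt; rewrite lee_fin mulr_ge0 ?weight_ge0 ?p0.
- by rewrite lee_fin ltW// max_likelihood_gt0.
Qed.

Lemma evidence_S1 n : Theta (mle x n) ->
  evidence p1 p2 p3 n x S1 = max_likelihood x n * fine (weighted x n p1).
Proof.
have [mp1 p10 ip1] := hp1; move=> Tm.
rewrite /evidence /Rintegral integral_likelihood_S1// fineM//.
exact: weighted_fin.
Qed.

(** Substitution by gamma with the constant likelihood 1. *)
Lemma integral_transported_prior1 :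
  (\int[lebesgue3]_(theta in Theta) (transported_prior p2 theta)%:E = 1)%E.
Proof.
have [mp2 p20 ip2] := hp2.
rewrite -[RHS]ip2.
transitivity (\int[lebesgue3]_(theta in Theta) (1 * transported_prior p2 theta)%:E)%E.
  by apply: eq_integral => theta _; rewrite mul1r.
rewrite -(@integral_transported_prior R p2 (cst 1))//.
by apply: eq_integral => theta _; rewrite mul1r.
Qed.

Lemma integral_likelihood_S2 n : Theta (mle x n) ->
  (\int[lebesgue3]_(theta in Theta) (likelihood S2 theta n x * p2 theta)%:E =
   (max_likelihood x n)%:E * weighted x n (transported_prior p2))%E.
Proof.
have [mp2 p20 ip2] := hp2; move=> Tm.
have mq := measurable_transported_prior mp2.
have q0 := transported_prior_ge0 p20.
have mL := @measurable_likelihood R S2 x n.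
have L0 (theta : R * R * R) (Tt : Theta theta) := @likelihood_ge0 R S2 theta x n Tt.
rewrite (@integral_transported_prior R p2 _ mp2 mL p20 L0).
rewrite -(integral_likelihood_S1 mq q0 Tm).
apply: eq_integral => theta /set_mem Tt.
have h := @likelihood_gamma R theta x n Tt.
exact: (congr1 (fun l => (l * transported_prior p2 theta)%:E) h).
Qed.

Lemma evidence_S2 n : Theta (mle x n) ->
  evidence p1 p2 p3 n x S2 =
  max_likelihood x n * fine (weighted x n (transported_prior p2)).
Proof.
have [mp2 p20 ip2] := hp2; move=> Tm.
have mq := measurable_transported_prior mp2.
have q0 := transported_prior_ge0 p20.
rewrite /evidence /Rintegral integral_likelihood_S2// fineM//.
exact: (weighted_fin mq q0 integral_transported_prior1 Tm).
Qed.

Lemma evidence_S3_le n b : Theta (mle x n) -> 0 <= b ->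
  (forall s1 s2, Theta3 (s1, s2) -> weight x n (0, s1, s2) <= b) ->
  0 <= evidence p1 p2 p3 n x S3 <= max_likelihood x n * b.
Proof.
have [mp3 p30 ip3] := hp3; move=> Tm b0 wb.
have M0 := max_likelihood_gt0 n.
have L0 (tau : R * R) : Theta3 tau -> 0 <= likelihood S3 (0, tau.1, tau.2) n x * p3 tau.
  by move=> Tt; rewrite mulr_ge0 ?p30// likelihood_ge0.
have int0 : (0 <= \int[lebesgue2]_(tau in Theta3)
    (likelihood S3 (0, tau.1, tau.2) n x * p3 tau)%:E)%E.
  by apply: integral_ge0 => tau Tt; rewrite lee_fin L0.
have intle : (\int[lebesgue2]_(tau in Theta3)
    (likelihood S3 (0, tau.1, tau.2) n x * p3 tau)%:E <= (max_likelihood x n * b)%:E)%E.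
  apply: (@le_trans _ _ (\int[lebesgue2]_(tau in Theta3)
      ((max_likelihood x n * b)%:E * (p3 tau)%:E))%E).
    apply: ge0_le_integral => //.
    - exact: measurable_Theta3.
    - apply/measurable_EFinP; apply: measurable_funM => //.
      apply: (@measurable_comp _ _ _ _ (mR3 R) _ (Theta : set (mR3 R))
        (fun theta => likelihood S3 theta n x) _
        (fun tau : mR2 R => ((0 : R), tau.1, tau.2) : mR3 R)).
      + exact: measurable_Theta.
      + by move=> _ [tau Tt <-].
      + exact: measurable_likelihood.
      + by apply: measurable_funTS; apply: measurable_triple.
    - by apply/measurable_EFinP; apply: measurable_funM.
    move=> [s1 s2] Tt; rewrite -EFinM lee_fin ler_wpM2r ?p30//.
    by rewrite likelihood_S3// likelihood_weight// ler_pM2l// wb.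
  rewrite ge0_integralZl//; last 3 first.
  - exact: measurable_Theta3.
  - exact/measurable_EFinP.
  - by rewrite lee_fin mulr_ge0// ltW.
  by rewrite ip3 mule1.
have fin : (\int[lebesgue2]_(tau in Theta3)
    (likelihood S3 (0, tau.1, tau.2) n x * p3 tau)%:E \is a fin_num)%E.
  by rewrite ge0_fin_numE// (le_lt_trans intle)// ltry.
rewrite /evidence /Rintegral fine_ge0//=.
by rewrite -lee_fin fineK.
Qed.

(** The maximal likelihood is a common factor of the three evidences. *)
Lemma posterior_cvg :
  posterior p1 p2 p3 n x S1 @[n --> \oo] -->
  1 / (1 + transported_prior p2 theta0 / p1 theta0).
Proof.
have [mp1 p10 ip1] := hp1; have [mp2 p20 ip2] := hp2.
have mq := measurable_transported_prior mp2.
have q0 := transported_prior_ge0 p20.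
have iq := integral_transported_prior1.
have cq := continuous_transported_prior T0 cp2.
have nT := near_mle_Theta T0 cmle.
have c2 := weighted_ratio_cvg T0 cmle mp1 mq p10 q0 ip1 iq cp1 cq pos.
set b := fun n => fine (weighted x n p1) in c2.
set a2 := fun n => fine (weighted x n (transported_prior p2)) in c2.
pose a3 n := evidence p1 p2 p3 n x S3 / max_likelihood x n.
have nb : \forall n \near \oo, 0 < b n.
  have := weight_concentration T0 cmle mp1 p10 cp1 pos ltr01 ltr01.
  move=> h; near=> n.
  have Tm : Theta (mle x n) by near: n.
  have [+ _] : (0 < weighted x n p1)%E /\ forall theta, Theta theta ->
    ~ box3 theta0 1 theta -> ((weight x n theta)%:E <= 1%:E * weighted x n p1)%E by near: n.
  by rewrite -(fineK (weighted_fin mp1 p10 ip1 Tm)) lte_fin.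
have c3 : a3 n / b n @[n --> \oo] --> (0 : R).
  apply/cvgrPdist_le => eps e0.
  have small := weight_independence_small T0 cmle w0 mp1 p10 cp1 pos e0.
  near=> n.
  have Tm : Theta (mle x n) by near: n.
  have b0 : 0 < b n by near: n.
  have sm : forall s1 s2, Theta3 (s1, s2) ->
    ((weight x n (0, s1, s2))%:E <= eps%:E * weighted x n p1)%E by near: n.
  have /andP[E0 Ele] : 0 <= evidence p1 p2 p3 n x S3 <= max_likelihood x n * (eps * b n).
    apply: evidence_S3_le => //; first by rewrite mulr_ge0// ltW.
    move=> s1 s2 /sm; rewrite -(fineK (weighted_fin mp1 p10 ip1 Tm)) -EFinM.
    by rewrite lee_fin.
  have M0 := max_likelihood_gt0 n.
  rewrite sub0r normrN ger0_norm; last first.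
    by rewrite /a3 divr_ge0 ?(ltW b0)// divr_ge0// ltW.
  by rewrite ler_pdivrMr// /a3 ler_pdivrMr// mulrC.
have c : 1 / (1 + (a2 n / b n + a3 n / b n)) @[n --> \oo] -->
    1 / (1 + (transported_prior p2 theta0 / p1 theta0 + 0)).
  apply: cvgM; first exact: cvg_cst.
  apply: cvgV.
    rewrite addr0 gt_eqF// ltr_pwDl// divr_ge0 ?q0// ltW//.
  by apply: cvgD; [exact: cvg_cst|exact: cvgD].
rewrite addr0 in c; apply: cvg_trans c; apply: near_eq_cvg.
near=> n.
have Tm : Theta (mle x n) by near: n.
have b0 : 0 < b n by near: n.
have M0 := max_likelihood_gt0 n.
have a20 : 0 <= a2 n by rewrite fine_ge0// weighted_ge0.
have a30 : 0 <= a3 n.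
  rewrite divr_ge0 ?(ltW M0)//.
  have [_ p30 _] := hp3.
  apply: Rintegral_ge0 => tau Tt; rewrite mulr_ge0 ?p30// likelihood_ge0//.
have E3 : evidence p1 p2 p3 n x S3 = max_likelihood x n * a3 n.
  by rewrite /a3 mulrC divfK// gt_eqF.
rewrite /posterior evidence_S1// evidence_S2// E3 -/(b n) -/(a2 n).
exact/esym/posterior_algebra.
Unshelve. all: by end_near. Qed.

End posterior_limit.

Lemma mle_cvg (R : realType) (x : nat -> R * R) (w t1 t2 : R) : Theta (w, t1, t2) ->
  mean_sqr1 x n @[n --> \oo] --> w ^+ 2 * t2 + t1 ->
  mean_cross x n @[n --> \oo] --> w * t2 ->
  mean_sqr2 x n @[n --> \oo] --> t2 ->
  mle x n @[n --> \oo] --> (w, t1, t2).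
Proof.
move=> [/= t10 t20] cA cB cC.
have t2n : t2 != 0 by rewrite gt_eqF.
have cW : mean_cross x n / mean_sqr2 x n @[n --> \oo] --> w.
  by rewrite -[X in _ --> X](mulfK t2n); apply: cvgM => //; exact: cvgV.
have cV : mean_sqr1 x n - mean_cross x n ^+ 2 / mean_sqr2 x n @[n --> \oo] --> t1.
  have -> : t1 = w ^+ 2 * t2 + t1 - (w * t2) * (w * t2) / t2 by field.
  apply: cvgB => //; apply: cvgM; last exact: cvgV.
  by under eq_fun do rewrite expr2; exact: cvgM.
exact: (cvg_pair (cvg_pair cW cV) cC).
Qed.

Theorem theorem3p1 (R : realType)
  (d : measure_display) (Omega : measurableType d) (P : probability Omega R)
  (X : nat -> {RV P >-> mR2 R})
  (w t1 t2 : R)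
  (hTheta : Theta (w, t1, t2))
  (hw : 0 < `|w|)
  (hindep : independent_sequence X)
  (hlaw : forall (i : nat) (A : set (mR2 R)), measurable A ->
     distribution P (X i) A = law S1 (w, t1, t2) A)
  (p1 p2 : R * R * R -> R) (p3 : R * R -> R)
  (hp1 : is_prior lebesgue3 Theta p1)
  (hp2 : is_prior lebesgue3 Theta p2)
  (hp3 : is_prior lebesgue2 Theta3 p3)
  (hd1 : times_differentiable 4 Theta p1)
  (hd2 : times_differentiable 4 Theta p2)
  (hd3 : times_differentiable 4 Theta3 p3)
  (hpos : 0 < p1 (w, t1, t2)) :
  {ae P, forall omega : Omega,
     posterior p1 p2 p3 n (fun i => X i omega) S1 @[n --> \oo] -->
     1 / (1 + t2 / (w ^+ 2 * t2 + t1)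
              * (p2 (gamma (w, t1, t2)) / p1 (w, t1, t2)))} /\
  t2 / (w ^+ 2 * t2 + t1) * (p2 (gamma (w, t1, t2)) / p1 (w, t1, t2)) =
  density_on_Theta (pushforward_prior p2) (w, t1, t2) / p1 (w, t1, t2).
Proof.
have [t10 t20] := hTheta.
have cp1 := times_differentiable_continuous hd1 hTheta.
have cp2 theta (Tt : Theta theta) := times_differentiable_continuous hd2 Tt.
have [mp2 p20 _] := hp2.
have limE : t2 / (w ^+ 2 * t2 + t1) * (p2 (gamma (w, t1, t2)) / p1 (w, t1, t2)) =
    transported_prior p2 (w, t1, t2) / p1 (w, t1, t2).
  by rewrite /transported_prior /gamma_jacobian mulrCA mulrA.
split; last by rewrite limE density_on_Theta_pushforward.
rewrite limE.
have aeA := empirical_square_cvg t10 t20 hindep hlaw 1 0.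
have aeC := empirical_square_cvg t10 t20 hindep hlaw 0 1.
have aeD := empirical_square_cvg t10 t20 hindep hlaw 1 1.
apply: filterS3 aeA aeC aeD => omega cA cC cD.
have w0 : w != 0 by rewrite -normr_gt0.
apply: posterior_cvg => //; last first.
  exact/cp2/gamma_Theta.
set x := fun i => X i omega : R * R.
have cA' : mean_sqr1 x n @[n --> \oo] --> w ^+ 2 * t2 + t1.
  have -> : w ^+ 2 * t2 + t1 = 1 ^+ 2 * t1 + (1 * w + 0) ^+ 2 * t2 by ring.
  apply: cvg_trans cA; apply: near_eq_cvg; apply: nearW => n; rewrite /mean_sqr1.
  by congr (_ / _); apply: eq_bigr => i _; rewrite mul1r mul0r addr0.
have cC' : mean_sqr2 x n @[n --> \oo] --> t2.
  have -> : t2 = 0 ^+ 2 * t1 + (0 * w + 1) ^+ 2 * t2 by ring.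
  apply: cvg_trans cC; apply: near_eq_cvg; apply: nearW => n; rewrite /mean_sqr2.
  by congr (_ / _); apply: eq_bigr => i _; rewrite mul1r mul0r add0r.
apply: mle_cvg => //.
have -> : w * t2 = (1 ^+ 2 * t1 + (1 * w + 1) ^+ 2 * t2 - (w ^+ 2 * t2 + t1) - t2) / 2.
  by field.
have cB : ((\sum_(i < n) (1 * (X i omega).1 + 1 * (X i omega).2) ^+ 2) / n%:R -
    mean_sqr1 x n - mean_sqr2 x n) / 2 @[n --> \oo] -->
    (1 ^+ 2 * t1 + (1 * w + 1) ^+ 2 * t2 - (w ^+ 2 * t2 + t1) - t2) / 2.
  apply: cvgM; last exact: cvg_cst.
  by apply: cvgB => //; exact: cvgB.
apply: cvg_trans cB; apply: near_eq_cvg; apply: nearW => n.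
rewrite /mean_sqr1 /mean_cross /mean_sqr2 -!mulrBl -!sumrB mulrAC; congr (_ / _).
by rewrite mulr_suml; apply: eq_bigr => i _; rewrite /x; field.
Qed.
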